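(* Let $G$ be a graph with a Kempe coloring $\mathfrak{C}$ of order $5$ (that is, $|\mathfrak{C}|=5$) and let $T$ be a transversal of $\mathfrak{C}$ such that $G[T]$ is connected. Then there exists a rooted $K_T$-certificate in $G$.
   Context: All graphs are finite, undirected, and simple. An anticlique is a set of pairwise nonadjacent vertices. A coloring of a graph $G$ is a partition $\mathfrak{C}$ of $V(G)$ into anticliques (nonempty, called color classes). A transversal of $\mathfrak{C}$ is a set $T$ containing exactly one element of each member of $\mathfrak{C}$ and nothing else. A Kempe chain is a connected component of $G[A\cup B]$ for some $A\neq B$ from $\mathfrak{C}$. A coloring $\mathfrak{C}$ is a Kempe coloring if any two vertices from distinct color classes belong to the same Kempe chain, i.e., the union of any two distinct color classes induces a connected subgraph of $G$. $K_T$ denotes the complete graph on the vertex set $T$. For a graph $H$ with $V(H)\subseteq V(G)$, a rooted $H$-certificate in $G$ is a family $(V_t)_{t\in V(H)}$ of pairwise disjoint subsets of $V(G)$ such that $t\in V_t$ and $G[V_t]$ is connected for all $t\in V(H)$, and for every $st\in E(H)$ there is an edge of $G$ connecting $V_s$ and $V_t$. *)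

(* Defs.v *)
From mathcomp Require Import all_boot.

Set Implicit Arguments.
Unset Strict Implicit.
Unset Printing Implicit Defensive.

(* The vertex set is a subset of an ambient finite type V, so that graphs on
   different vertex sets, such as G and K_T with T a set of vertices of G, can
   be compared. *)
Record graph (V : finType) := Graph {
  vertices : {set V};
  adj : rel V;
  adj_sym : symmetric adj;
  adj_irrefl : irreflexive adj;
  adj_vertices : forall x y, adj x y -> x \in vertices
}.

Section Graphs.

Variable V : finType.
Implicit Types (G H : graph V) (A B K T X : {set V}) (C : {set {set V}}).

Definition induced_adj G X : rel V :=
  [rel x y | [&& x \in X, y \in X & adj G x y]].

Lemma induced_adj_sym G X : symmetric (induced_adj G X).
Proof. by move=> x y; rewrite /induced_adj /= adj_sym andbCA. Qed.

Lemma induced_adj_irrefl G X : irreflexive (induced_adj G X).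
Proof. by move=> x; rewrite /induced_adj /= adj_irrefl !andbF. Qed.

Lemma induced_adj_vertices G X x y :
  induced_adj G X x y -> x \in vertices G :&: X.
Proof. by case/and3P=> xX _ /adj_vertices xG; rewrite inE xG. Qed.

Definition induced G X : graph V :=
  Graph (@induced_adj_sym G X) (@induced_adj_irrefl G X)
        (@induced_adj_vertices G X).

Definition complete_adj T : rel V :=
  [rel x y | [&& x \in T, y \in T & x != y]].

Lemma complete_adj_sym T : symmetric (complete_adj T).
Proof. by move=> x y; rewrite /complete_adj /= eq_sym andbCA. Qed.

Lemma complete_adj_irrefl T : irreflexive (complete_adj T).
Proof. by move=> x; rewrite /complete_adj /= eqxx !andbF. Qed.

Lemma complete_adj_vertices T x y : complete_adj T x y -> x \in T.
Proof. by case/and3P. Qed.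

Definition complete_graph T : graph V :=
  Graph (@complete_adj_sym T) (@complete_adj_irrefl T)
        (@complete_adj_vertices T).

(* The empty graph is not connected. *)
Definition connected G : bool :=
  (vertices G != set0) &&
  [forall x in vertices G, forall y in vertices G, connect (adj G) x y].

Definition components G : {set {set V}} :=
  equivalence_partition (connect (adj G)) (vertices G).

Definition anticlique G A : bool :=
  (A \subset vertices G) && [forall x in A, forall y in A, ~~ adj G x y].

(* [partition] already excludes empty color classes. *)
Definition coloring G C : bool :=
  partition C (vertices G) && [forall A in C, anticlique G A].

Definition kempe_chain G C K : Prop :=
  exists A B, [/\ A \in C, B \in C, A != B &
                  K \in components (induced G (A :|: B))].

Definition kempe_coloring G C : Prop :=
  coloring G C /\
  forall A B, A \in C -> B \in C -> A != B ->
  forall x y, x \in A -> y \in B ->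
  exists K, [/\ kempe_chain G C K, x \in K & y \in K].

(* Only the values of W on the vertices of H matter. *)
Definition rooted_certificate G H (W : V -> {set V}) : Prop :=
  [/\ {in vertices H, forall t, W t \subset vertices G},
      {in vertices H &, forall s t, s != t -> [disjoint W s & W t]},
      {in vertices H, forall t, t \in W t /\ connected (induced G (W t))} &
      forall s t, adj H s t ->
        exists x y, [/\ x \in W s, y \in W t & adj G x y]].

Lemma connect_adj_equiv G :
  {in vertices G & &, equivalence_rel (connect (adj G))}.
Proof.
move=> x y z _ _ _; split=> // xy.
by apply: (same_connect (sym_connect_sym (@adj_sym _ G))).
Qed.

Lemma kempe_coloringP G C :
  kempe_coloring G C <->
  coloring G C /\
  forall A B, A \in C -> B \in C -> A != B -> connected (induced G (A :|: B)).
Proof.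
have sub A : coloring G C -> A \in C -> A \subset vertices G.
  by case/andP=> _ /forall_inP aC /aC /andP[].
split=> -[colC kC]; split=> // A B AC BC AB.
  have /andP[/and3P[_ tC C0] _] := colC.
  have [x0 x0A] : exists x, x \in A by apply/set0Pn; apply: contraNneq C0 => <-.
  have [y0 y0B] : exists x, x \in B by apply/set0Pn; apply: contraNneq C0 => <-.
  have crossAB x y : x \in A -> y \in B ->
      connect (adj (induced G (A :|: B))) x y.
    move=> xA yB; have [K [[A' [B' [A'C B'C _ KC]]] xK yK]] := kC A B AC BC AB x y xA yB.
    have /and3P[/eqP cK tK _] :=
      equivalence_partitionP (@connect_adj_equiv (induced G (A' :|: B'))).
    have inK z : z \in K -> z \in A' :|: B'.
      move=> zK; have : z \in cover (components (induced G (A' :|: B'))).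
        by apply/bigcupP; exists K.
      by rewrite cK inE => /andP[].
    have same D D' z : D \in C -> D' \in C -> z \in D -> z \in D' -> D = D'.
      by move=> DC D'C zD zD'; rewrite -(def_pblock tC DC zD) (def_pblock tC D'C zD').
    have eqAB : A' :|: B' = A :|: B.
      move: (inK x xK) (inK y yK); rewrite !inE.
      case/orP=> xD /orP[] yD.
      - by move: AB; rewrite (same A A' x) // (same B A' y) // eqxx.
      - by rewrite (same A A' x) // (same B B' y).
      - by rewrite (same A B' x) // (same B A' y) // setUC.
      - by move: AB; rewrite (same A B' x) // (same B B' y) // eqxx.
    rewrite -eqAB.
    have xG : x \in vertices (induced G (A' :|: B')).
      by rewrite inE inK // andbT (subsetP (sub A colC AC)).
    have yG : y \in vertices (induced G (A' :|: B')).
      by rewrite inE inK // andbT (subsetP (sub B colC BC)).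
    rewrite -(pblock_equivalence_partition (@connect_adj_equiv _) xG yG).
    by rewrite (def_pblock tK KC xK).
  have csym := sym_connect_sym (adj_sym (induced G (A :|: B))).
  apply/andP; split.
    by apply/set0Pn; exists x0; rewrite !inE x0A (subsetP (sub A colC AC)).
  apply/forall_inP=> x; rewrite !inE => /andP[_ xAB].
  apply/forall_inP=> y; rewrite !inE => /andP[_ yAB].
  case/orP: xAB => xD; case/orP: yAB => yD.
  - by rewrite (connect_trans (crossAB x y0 xD y0B)) // csym crossAB.
  - exact: crossAB.
  - by rewrite csym crossAB.
  - by rewrite csym (connect_trans _ (crossAB x0 x x0A xD)) // csym crossAB.
move=> x y xA yB; have /andP[_ /forall_inP con] := kC A B AC BC AB.
have xG : x \in vertices (induced G (A :|: B)).
  by rewrite !inE xA (subsetP (sub A colC AC)).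
have yG : y \in vertices (induced G (A :|: B)).
  by rewrite !inE yB orbT (subsetP (sub B colC BC)).
have /and3P[/eqP cK _ _] :=
  equivalence_partitionP (@connect_adj_equiv (induced G (A :|: B))).
exists (pblock (components (induced G (A :|: B))) x); split.
- by exists A, B; split; rewrite // pblock_mem // cK.
- by rewrite mem_pblock cK.
- rewrite pblock_equivalence_partition //; last exact: connect_adj_equiv.
  by have /forall_inP := con x xG; apply.
Qed.

End Graphs.

(* Main.v *)
Require Import Defs.
From mathcomp Require Import all_boot.

(* The heart of the matter is a rooted K4 theorem: four pairwise disjoint
   connected root sets, any two of which are joined inside the union of their two
   color classes, extend to a rooted K4.  Four of the six bichromatic links give a
   rooted C4; the two remaining links, R between the first and third root and B
   between the second and fourth, either supply both diagonals or lead, by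
   rerouting that enlarges the parts of the C4 reachable inside R and B, to a hub:
   two disjoint connected sets, one of them containing a root set, that both touch
   three sets rooted at the other roots.  A minimal hub is so thin that some link
   has to leave one of these three sets through a specified vertex; recoloring that
   vertex enlarges a root set, and one concludes by induction.

   A connected graph on five vertices has a vertex c of degree at least three or
   a Hamiltonian path.  In the first case the K4 theorem applies after deleting c,
   where the class of c and the class of the remaining root d are merged and the
   root set of d is the part reachable from d, so that it touches c.  In the second
   case, t1 .. t5, fix a path P from t2 to t4 in their two classes and split the
   vertices outside P and t3 into connected sets around t1 and t5 that are both
   next to t3 and are not separated by any edge between the classes of t1 and t4 or
   between those of t5 and t2.  Some vertex of P in the class of t4, and another
   one in the class of t2, then touch both sides, and P is cut between them. *)

Set Implicit Arguments.
Unset Strict Implicit.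
Unset Printing Implicit Defensive.

(** * Connected sets *)

Section Conn.
Variables (V : finType) (e : rel V).
Hypothesis eC : symmetric e.
Implicit Types (A B R S T W X Y Z : {set V}) (v x y z : V).

Definition restr S : rel V := [rel x y | [&& x \in S, y \in S & e x y]].
Definition conn S := S != set0 /\ {in S &, forall x y, connect (restr S) x y}.
Definition touch X Y := exists x y, [/\ x \in X, y \in Y & e x y].
Definition reach S T := [set x in S | [exists t in T, connect (restr S) t x]].

Lemma restrC S : symmetric (restr S).
Proof. by move=> x y; rewrite /restr /= eC andbCA. Qed.

Lemma connect_exit (r : rel V) X x y :
  connect r x y -> x \in X -> y \notin X ->
  exists u v, [/\ u \in X, v \notin X & r u v].
Proof.
case/connectP=> p; elim: p x => [x _ -> xX /negP // | z p IH x /= /andP[xz zp] yE xX yX].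
have [zX|zX] := boolP (z \in X); first exact: IH zp yE zX yX.
by exists x, z.
Qed.

Lemma conn_exit S X x y :
  conn S -> x \in S -> x \in X -> y \in S -> y \notin X ->
  exists u v, [/\ u \in S, u \in X, v \in S, v \notin X & e u v].
Proof.
case=> _ cS xS xX yS yX.
have [u [v [uX vX /and3P[uS vS uv]]]] := connect_exit (cS x y xS yS) xX yX.
by exists u, v.
Qed.

(** Connectedness by cuts, the converse of [conn_exit]. Applied to the set of vertices reachable
    from [x], the hypothesis yields an edge leaving that set, which is absurd. *)
Lemma conn_intro S :
  S != set0 ->
  (forall X x y, x \in S -> x \in X -> y \in S -> y \notin X ->
     exists u v, [/\ u \in S, u \in X, v \in S, v \notin X & e u v]) ->
  conn S.
Proof.
move=> S0 H; split=> // x y xS yS; pose X := [set z | connect (restr S) x z].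
have [yX|yX] := boolP (y \in X); first by rewrite inE in yX.
have [|u [v [uS]]] := H X x y xS _ yS yX; first by rewrite inE.
rewrite inE => xu vS + uv; rewrite inE => /negP[]; apply: connect_trans xu _.
by apply: connect1; rewrite /restr /= uS vS.
Qed.

Lemma conn1 x : conn [set x].
Proof.
split; first by apply/set0Pn; exists x; rewrite inE.
by move=> y z; rewrite !inE => /eqP-> /eqP->; apply: connect0.
Qed.

Lemma touchC X Y : touch X Y -> touch Y X.
Proof. by case=> x [y [xX yY xy]]; exists y, x; rewrite eC. Qed.

Lemma touchS X X' Y Y' :
  X \subset X' -> Y \subset Y' -> touch X Y -> touch X' Y'.
Proof.
move=> /subsetP sX /subsetP sY [x [y [xX yY xy]]].
by exists x, y; rewrite sX ?sY.
Qed.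

Definition touchb X Y := [exists x in X, exists y in Y, e x y].

Lemma touchP X Y : reflect (touch X Y) (touchb X Y).
Proof.
apply: (iffP exists_inP) => [[x xX /exists_inP[y yY xy]]|[x [y [xX yY xy]]]].
  by exists x, y.
by exists x => //; apply/exists_inP; exists y.
Qed.

Lemma connU_meet X Y z : conn X -> conn Y -> z \in X -> z \in Y -> conn (X :|: Y).
Proof.
move=> cX cY zX zY; apply: conn_intro; first by apply/set0Pn; exists z; rewrite inE zX.
move=> S x y xXY xS yXY yS.
have [zS|zS] := boolP (z \in S).
  move: yXY; rewrite inE => /orP[] yX.
    have [u [v [uX uS vX vS uv]]] := conn_exit cX zX zS yX yS.
    by exists u, v; rewrite !inE uX vX.
  have [u [v [uX uS vX vS uv]]] := conn_exit cY zY zS yX yS.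
  by exists u, v; rewrite !inE uX vX !orbT.
move: xXY; rewrite inE => /orP[] xX.
  have [u [v [uX uS vX vS uv]]] := conn_exit cX xX xS zX zS.
  by exists u, v; rewrite !inE uX vX.
have [u [v [uX uS vX vS uv]]] := conn_exit cY xX xS zY zS.
by exists u, v; rewrite !inE uX vX !orbT.
Qed.

Lemma conn2 x y : e x y -> conn [set x; y].
Proof.
move=> xy; apply: conn_intro; first by apply/set0Pn; exists x; rewrite !inE eqxx.
move=> S u v; rewrite !inE => /orP[] /eqP-> uS /orP[] /eqP-> vS.
- by rewrite uS in vS.
- by exists x, y; rewrite !inE !eqxx orbT.
- by exists y, x; rewrite !inE !eqxx orbT eC.
- by rewrite uS in vS.
Qed.

Lemma connU X Y : conn X -> conn Y -> touch X Y -> conn (X :|: Y).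
Proof.
move=> cX cY [x [y [xX yY xy]]].
have c1 : conn (X :|: [set x; y]) by apply: connU_meet (conn2 xy) xX _ => //; rewrite !inE eqxx.
have -> : X :|: Y = (X :|: [set x; y]) :|: Y.
  apply/setP=> z; rewrite !inE; case: eqP => [->|_]; first by rewrite xX.
  by case: eqP => [->|_]; rewrite ?yY ?orbT ?orbF.
by apply: connU_meet c1 cY _ yY; rewrite !inE eqxx !orbT.
Qed.

(** A connected dominating set makes the whole set connected. It serves for the set left after a
    path and one root have been deleted. *)
Lemma conn_attach S B :
  conn S -> S \subset B ->
  (forall z, z \in B -> z \notin S -> exists2 y, y \in S & e z y) -> conn B.
Proof.
move=> cS /subsetP SB H; have [/set0Pn[s sS] _] := cS.
apply: conn_intro; first by apply/set0Pn; exists s; apply: SB.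
move=> X x y xB xX yB yX.
have [/exists_inP[u uS uX]|] := boolP [exists u in S, u \in X].
  have [yS|/(H y yB)[v vS yv]] := boolP (y \in S).
    have [a [b [aS aX bS bX ab]]] := conn_exit cS uS uX yS yX.
    by exists a, b; rewrite !SB.
  have [vX|vX] := boolP (v \in X); first by exists v, y; split=> //; [apply: SB|rewrite eC].
  have [a [b [aS aX bS bX ab]]] := conn_exit cS uS uX vS vX.
  by exists a, b; rewrite !SB.
rewrite negb_exists_in => /forall_inP noX.
have [xS|/(H x xB)[v vS xv]] := boolP (x \in S); first by move: (noX x xS); rewrite xX.
by exists x, v; split=> //; [apply: SB|apply: noX].
Qed.

Lemma reach_sub S T : reach S T \subset S.
Proof. by apply/subsetP=> x; rewrite inE => /andP[]. Qed.

Lemma sub_reach S T : T \subset S -> T \subset reach S T.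
Proof.
move=> /subsetP TS; apply/subsetP=> x xT; rewrite inE TS //=.
by apply/exists_inP; exists x.
Qed.

Lemma reach_closed S T x y : x \in reach S T -> y \in S -> e x y -> y \in reach S T.
Proof.
rewrite !inE => /andP[xS /exists_inP[t tT tx]] yS xy; rewrite yS /=.
apply/exists_inP; exists t => //; apply: connect_trans tx _.
by apply: connect1; rewrite /restr /= xS yS.
Qed.

Lemma reach_max S T X x :
  conn X -> X \subset S -> x \in X -> x \in reach S T -> X \subset reach S T.
Proof.
move=> cX /subsetP XS xX xC; apply/subsetP=> y yX; apply: contraT => yC.
have [u [v [uX uC vX vC uv]]] := conn_exit cX xX xC yX yC.
by move: vC; rewrite (reach_closed uC) // XS.
Qed.

Lemma conn_reach S T : conn T -> T \subset S -> conn (reach S T).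
Proof.
move=> cT TS; have [/set0Pn[t tT] _] := cT.
have tC : t \in reach S T by apply: (subsetP (sub_reach TS)).
apply: conn_intro; first by apply/set0Pn; exists t.
have reach x : x \in reach S T -> forall X, ~~ [exists u in T, u \in X] -> x \in X ->
    exists u v, [/\ u \in reach S T, u \in X, v \in reach S T, v \notin X & e u v].
  move=> xC X; rewrite negb_exists_in => /forall_inP noX xX; move: (xC).
  rewrite inE => /andP[xS /exists_inP[s sT sx]].
  rewrite (sym_connect_sym (@restrC S)) in sx.
  have [u [v [uX vX /and3P[_ vS uv]]]] :=
    @connect_exit (restr S) (X :&: reach S T) x s sx
      ltac:(by rewrite inE xX) ltac:(by rewrite inE negb_and noX).
  move: uX; rewrite inE => /andP[uX uC]; have vC := reach_closed uC vS uv.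
  by exists u, v; move: vX; rewrite inE vC andbT.
move=> X x y xC xX yC yX.
have [/exists_inP[u uT uX]|nX] := boolP [exists u in T, u \in X]; last exact: reach nX xX.
have [/forall_inP aX|] := boolP [forall u in T, u \in X]; last first.
  rewrite negb_forall_in => /exists_inP[w wT wX].
  have [a [b [aT aX bT bX ab]]] := conn_exit cT uT uX wT wX.
  by exists a, b; rewrite !(subsetP (sub_reach TS)).
have [||a [b [aC + bC + ab]]] := reach y yC (~: X).
- by apply/exists_inP=> -[w wT]; rewrite inE aX.
- by rewrite inE.
by rewrite !inE negbK => aX' bX; exists b, a; rewrite eC.
Qed.

(** Every edge of [B] that leaves the reachable part ends in [S]. A walk that enters this part
    therefore comes from [S] and returns to [S], and the connected set [S] replaces the detour. *)
Lemma peel B S T :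
  conn B -> conn S -> S \subset B -> conn T -> T \subset B :\: S ->
  conn (B :\: reach (B :\: S) T) /\ touch (reach (B :\: S) T) S.
Proof.
move=> cB cS /subsetP SB cT TB; set K := reach _ _.
have [/set0Pn[s sS] _] := cS; have [/set0Pn[t tT] _] := cT.
have KB x : x \in K -> (x \in B) && (x \notin S).
  by move=> /(subsetP (reach_sub _ _)); rewrite inE andbC.
have SK x : x \in S -> x \notin K.
  by move=> xS; apply/negP=> /KB; rewrite xS andbF.
have tK : t \in K by apply: (subsetP (sub_reach TB)).
have outK u v : u \in K -> v \in B -> v \notin K -> e u v -> v \in S.
  move=> uK vB vK uv; apply: contraR vK => vS.
  by apply: reach_closed uK _ uv; rewrite inE vS.
move: K KB SK tK outK => K KB SK tK outK.
split; last first.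
  have tB : t \in B by case/andP: (KB t tK).
  have [u [v [uB uK vB vK uv]]] := conn_exit cB tB tK (SB s sS) (SK s sS).
  by exists u, v; rewrite (outK u v).
apply: conn_intro; first by apply/set0Pn; exists s; rewrite inE SB // SK.
move=> X x y; rewrite !inE => /andP[xK xB] xX /andP[yK yB] yX.
have stepS : [exists u in S, u \in X] -> [exists v in S, v \notin X] ->
    exists u v, [/\ u \in B :\: K, u \in X, v \in B :\: K, v \notin X & e u v].
  case/exists_inP=> u uS uX /exists_inP[v vS vX].
  have [a [b [aS aX bS bX ab]]] := conn_exit cS uS uX vS vX.
  by exists a, b; split=> //; rewrite inE ?(SK _ aS) ?(SK _ bS) SB.
(* When [S] does not straddle the cut, [K] is put on the side of [S]; the edge of [B] crossing the
   new cut has no end in [K]. *)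
have [sX|sX] := boolP (s \in X).
  have [wS|] := boolP [exists v in S, v \notin X].
    by apply: stepS => //; apply/exists_inP; exists s.
  rewrite negb_exists_in => /forall_inP allX.
  have [|||u [v [uB uX vB vX uv]]] := @conn_exit B (X :|: K) s y cB (SB s sS).
  - by rewrite inE sX.
  - by [].
  - by rewrite inE negb_or yX.
  move: uX vX; rewrite !inE negb_or => uX /andP[vX vK].
  have uK : u \notin K.
    by apply/negP=> uK; move: (allX v (outK u v uK vB vK uv)); rewrite vX.
  by move: uX; rewrite (negbTE uK) orbF => uX; exists u, v; rewrite !inE uK vK.
have [wS|] := boolP [exists u in S, u \in X].
  by apply: stepS => //; apply/exists_inP; exists s.
rewrite negb_exists_in => /forall_inP noX.
have [|||u [v [uB uX vB vX uv]]] := @conn_exit B (X :\: K) x s cB xB.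
- by rewrite inE xK.
- exact: SB.
- by rewrite inE (negbTE sX) andbF.
move: uX vX; rewrite !inE negb_and negbK => /andP[uK uX] vX.
have vK : v \notin K.
  apply/negP=> vK; move: (noX u); rewrite uX.
  by rewrite (outK v u) // 1?eC // => /(_ isT).
by rewrite (negbTE vK) /= in vX; exists u, v; rewrite !inE uK vK.
Qed.

(** A walk of [Z] enters and leaves [X] only through [p], so every detour into [X] can be cut off at
    [p]. *)
Lemma conn_setD Z X p :
  conn Z -> Z :\: X != set0 ->
  (forall u v, u \in X -> v \in Z -> v \notin X -> e u v -> v = p) ->
  conn (Z :\: X).
Proof.
move=> cZ ZX0 H; apply: conn_intro => // Y x y.
rewrite !inE => /andP[xX xZ] xY /andP[yX yZ] yY.
have [pY|pY] := boolP (p \in Y).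
  have [|||u [v [uZ + vZ + uv]]] := @conn_exit Z (X :|: Y) x y cZ xZ.
  - by rewrite inE xY orbT.
  - by [].
  - by rewrite inE negb_or yX.
  rewrite !inE negb_or => uXY /andP[vX vY].
  have uX : u \notin X.
    by apply/negP=> uX; move: vY; rewrite (H u v) ?pY.
  by rewrite (negbTE uX) in uXY; exists u, v; rewrite !inE uX vX.
have [|||u [v [uZ + vZ + uv]]] := @conn_exit Z (Y :\: X) x y cZ xZ.
- by rewrite inE xX.
- by [].
- by rewrite inE (negbTE yY) andbF.
rewrite !inE negb_and negbK => /andP[uX uY] vX.
have vX' : v \notin X.
  by apply/negP=> vX'; move: pY; rewrite -(H v u) ?uY // eC.
by rewrite (negbTE vX') /= in vX; exists u, v; rewrite !inE uX vX'.
Qed.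

(** [S] grows inside [U] by one adjacent vertex at a time and stays connected; the last vertex added
    is not a cut vertex of [U]. *)
Lemma noncut S U :
  conn U -> conn S -> S \proper U ->
  exists x, [/\ x \in U, x \notin S & conn (U :\ x)].
Proof.
move=> cU; have [n] := ubnP (#|U| - #|S|); elim: n S => // n IH S le_n cS SU.
have [/subsetP sSU [y yU yS]] := properP SU; have [/set0Pn[s sS] _] := cS.
have [u [v [uU uS vU vS uv]]] := conn_exit cU (sSU s sS) sS yU yS.
have cS' : conn (v |: S).
  rewrite setUC; apply: connU => //; first exact: conn1.
  by exists u, v; rewrite inE.
have sS' : v |: S \subset U by apply/subsetP=> z /setU1P[->//|/sSU].
have [eqU|neU] := eqVneq (v |: S) U.
  exists v; split=> //; suff -> : U :\ v = S by [].
  by rewrite -eqU setU1K.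
have [||x [xU xS cx]] := IH (v |: S) _ cS'; last 1 first.
- by exists x; split=> //; apply: contra xS => xS; rewrite inE xS orbT.
- have := proper_card SU; rewrite cardsU1 vS add1n => ltU.
  by rewrite subnS -ltnS prednK ?subn_gt0.
- by rewrite properEneq neU.
Qed.

Lemma disjP A B : reflect (forall x, ~~ ((x \in A) && (x \in B))) [disjoint A & B].
Proof.
apply: (iffP idP) => [dAB x|H].
  by apply/negP=> /andP[xA]; rewrite (disjointFr dAB xA).
by apply/pred0P=> x /=; apply/negbTE.
Qed.

Lemma subP A B : reflect (forall x, (x \in A) ==> (x \in B)) (A \subset B).
Proof.
by apply: (iffP subsetP) => H x; [apply/implyP; apply: H | apply/implyP].
Qed.

(* A hypothesis A \subset _ with A absent from the goal is dropped to keep the case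
   analysis small. *)
Ltac set_solve :=
  let x := fresh "x" in let G := fresh "G" in
  repeat match goal with
  | H : is_true (subset (mem (pred_of_set ?A)) _) |- ?g =>
    lazymatch g with context [A] => fail | _ => clear H end
  end;
  first [apply/disjP | apply/subP]; intros x; apply: contraT => G;
  repeat match goal with
  | H : is_true [disjoint _ & _] |- _ => move/disjP/(_ x): H
  | H : is_true (_ \subset _) |- _ => move/subP/(_ x): H
  end;
  move: G; rewrite ?(in_setU, in_setI, in_setD, in_set1);
  repeat (first [case: (x \in _) | case: (x == _)] => //=).

(** [K] is the component of [B :\ v] around [T], and [peel] with the single vertex [v] keeps the
    rest connected. The maximality clause later shows that a part of a rooted set survives the
    cut. *)
Lemma cutP B T v :
  conn B -> conn T -> T \subset B -> v \in B -> v \notin T ->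
  exists K, [/\ conn K, T \subset K, K \subset B & [/\ v \notin K, conn (B :\: K),
    exists2 k, k \in K & e k v &
    forall X, conn X -> X \subset B -> v \notin X -> T \subset X -> X \subset K]].
Proof.
move=> cB cT TB vB vT; pose K := reach (B :\ v) T.
have TBv : T \subset B :\: [set v].
  by apply/subsetP=> x xT; rewrite !inE (subsetP TB) // andbT; apply: contraNneq vT => <-.
have KB := reach_sub (B :\ v) T.
have [|cW [k [v' [kK /set1P-> kv]]]] := peel cB (conn1 v) _ cT TBv.
  by rewrite sub1set.
exists K; split.
- exact: conn_reach cT TBv.
- exact: sub_reach.
- by apply: subset_trans KB _; apply: subD1set.
split=> //; first by apply/negP=> /(subsetP KB); rewrite !inE eqxx.
  by exists k.
move=> X cX XB vX TX; have [/set0Pn[t tT] _] := cT.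
apply: (@reach_max _ _ _ t) => //; last by apply: (subsetP (sub_reach TBv)).
  by rewrite subsetD1 XB.
exact: (subsetP TX).
Qed.

(** * Rooted cycles and hubs *)

Definition rooted T W := conn W /\ T \subset W.

Definition disjoint4 W1 W2 W3 W4 :=
  [/\ [disjoint W1 & W2], [disjoint W1 & W3], [disjoint W1 & W4] &
  [/\ [disjoint W2 & W3], [disjoint W2 & W4] & [disjoint W3 & W4]]].

Definition rooted4 T1 T2 T3 T4 W1 W2 W3 W4 :=
  [/\ rooted T1 W1, rooted T2 W2, rooted T3 W3 & rooted T4 W4].

Definition rooted_K4 T1 T2 T3 T4 :=
  exists W1 W2 W3 W4, [/\ rooted4 T1 T2 T3 T4 W1 W2 W3 W4, disjoint4 W1 W2 W3 W4,
    [/\ touch W1 W2, touch W1 W3 & touch W1 W4] &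
    [/\ touch W2 W3, touch W2 W4 & touch W3 W4]].

Definition rooted_C4 T1 T2 T3 T4 W1 W2 W3 W4 :=
  [/\ rooted4 T1 T2 T3 T4 W1 W2 W3 W4, disjoint4 W1 W2 W3 W4 &
      [/\ touch W1 W2, touch W2 W3, touch W3 W4 & touch W4 W1]].

(** A rooted [K_{2,3}]: on the side of two, [A] contains a root set and [U] is free; the three sets
    on the other side are all rooted. *)
Definition hub_model T1 T2 T3 T4 A U W2 W3 W4 :=
  [/\ rooted4 T1 T2 T3 T4 A W2 W3 W4, disjoint4 A W2 W3 W4,
      conn U /\ [/\ [disjoint A & U], [disjoint U & W2], [disjoint U & W3] &
                  [disjoint U & W4]],
      [/\ touch A W2, touch A W3 & touch A W4] &
      [/\ touch U W2, touch U W3 & touch U W4]].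

Definition hub T1 T2 T3 T4 :=
  exists A U W2 W3 W4, hub_model T1 T2 T3 T4 A U W2 W3 W4.

Section FourRoots.
Variables T1 T2 T3 T4 : {set V}.
Hypotheses (cT1 : conn T1) (cT2 : conn T2) (cT3 : conn T3) (cT4 : conn T4).

(* The four sets are the least fixed point of going once around the cycle, each set
   being what its root reaches in its link while avoiding the next set. *)
Lemma C4_of_links X12 X23 X34 X41 :
  conn X12 -> conn X23 -> conn X34 -> conn X41 ->
  T1 \subset X12 -> T2 \subset X12 -> T2 \subset X23 -> T3 \subset X23 ->
  T3 \subset X34 -> T4 \subset X34 -> T4 \subset X41 -> T1 \subset X41 ->
  [disjoint X12 & X34] -> [disjoint X23 & X41] ->
  exists W1 W2 W3 W4, rooted_C4 T1 T2 T3 T4 W1 W2 W3 W4.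
Proof.
move=> c12 c23 c34 c41 s112 s212 s223 s323 s334 s434 s441 s141 d1 d2.
pose f X T W := reach (X :\: W) T.
pose F W := f X12 T1 (f X23 T2 (f X34 T3 (f X41 T4 W))).
(* [f] reverses inclusion in the avoided set, so the fourfold composition [F] preserves it. *)
have anti X T W W' : conn T -> T \subset X :\: W' -> W \subset W' -> f X T W' \subset f X T W.
  move=> cT TX WW'; have [/set0Pn[t tT] _] := cT.
  have TX' : T \subset X :\: W by apply: subset_trans TX _; apply: setDS.
  apply: (@reach_max _ _ _ t); first exact: conn_reach.
  - by apply: subset_trans (reach_sub _ _) _; apply: setDS.
  - exact: (subsetP (sub_reach TX)).
  - exact: (subsetP (sub_reach TX')).
have fX X T W : f X T W \subset X.
  by apply: subset_trans (reach_sub _ _) _; apply: subsetDl.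
have fW X T W : [disjoint f X T W & W].
  have : f X T W \subset X :\: W by apply: reach_sub.
  by move: (f X T W) => K KX; set_solve.
(* A root set is never blocked: it also lies in the link opposite to the one that contains the
   avoided set, and opposite links are disjoint. *)
have tX X T Y Z W : T \subset X -> T \subset Y -> [disjoint Y & Z] -> W \subset Z -> T \subset X :\: W.
  by move=> *; set_solve.
have link X T T' W : conn X -> conn T -> T \subset X :\: W -> T' \subset X -> conn T' -> T' \subset W ->
   touch (f X T W) W.
  move=> cX cT TXW T'X [/set0Pn[t' t'T'] _] T'W; have [/set0Pn[t tT] _] := cT.
  have tf : t \in f X T W by apply: (subsetP (sub_reach TXW)).
  have t'f : t' \notin f X T W.
    by apply/negP=> /(disjointFr (fW _ _ _)); rewrite (subsetP T'W).
  have [u [v [uX uf vX vf uv]]] :=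
    conn_exit cX (subsetP (fX X T W) t tf) tf (subsetP T'X _ t'T') t'f.
  exists u, v; split=> //; apply: contraR vf => vW.
  by apply: reach_closed uf _ uv; rewrite inE vW.
have d1' : [disjoint X34 & X12] by rewrite disjoint_sym.
have d2' : [disjoint X41 & X23] by rewrite disjoint_sym.
have t4 W : W \subset X12 -> T4 \subset X41 :\: W by apply: tX s441 s434 d1'.
have t3 W : W \subset X41 -> T3 \subset X34 :\: W by apply: tX s334 s323 d2.
have t2 W : W \subset X34 -> T2 \subset X23 :\: W by apply: tX s223 s212 d1.
have t1 W : W \subset X23 -> T1 \subset X12 :\: W by apply: tX s112 s141 d2'.
(* [fixset] asks for monotonicity on all sets, while [F] is controlled only below [X12]. The fixed
   point lies in [X12], where both maps agree. *)
pose F' W := F (W :&: X12).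
have F'mono : {homo F' : W W' / W \subset W'}.
  move=> W W' WW'; rewrite /F' /F.
  have s1 : W :&: X12 \subset W' :&: X12 by apply: setSI.
  have s2 := anti X41 T4 _ _ cT4 (t4 _ (subsetIr W' X12)) s1.
  have s3 := anti X34 T3 _ _ cT3 (t3 _ (fX X41 T4 _)) s2.
  have s4 := anti X23 T2 _ _ cT2 (t2 _ (fX X34 T3 _)) s3.
  exact: anti cT1 (t1 _ (fX X23 T2 _)) s4.
have := fixsetK F'mono; set W1 := fixset F'; rewrite /F' /F => eW1.
have W1X : W1 \subset X12 by rewrite -eW1; apply: fX.
rewrite (setIidPl W1X) in eW1.
set W4 := f X41 T4 W1 in eW1; set W3 := f X34 T3 W4 in eW1; set W2 := f X23 T2 W3 in eW1.
have r4 : rooted T4 W4 by split; [apply: conn_reach|apply: sub_reach] => //; apply: t4.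
have r3 : rooted T3 W3 by split; [apply: conn_reach|apply: sub_reach] => //; apply: t3; apply: fX.
have r2 : rooted T2 W2 by split; [apply: conn_reach|apply: sub_reach] => //; apply: t2; apply: fX.
have r1 : rooted T1 W1.
  by rewrite -eW1; split; [apply: conn_reach|apply: sub_reach] => //; apply: t1; apply: fX.
have x4 : W4 \subset X41 by apply: fX.
have x3 : W3 \subset X34 by apply: fX.
have x2 : W2 \subset X23 by apply: fX.
have e12 : [disjoint W1 & W2] by rewrite -eW1; apply: fW.
have e23 : [disjoint W2 & W3] by apply: fW.
have e34 : [disjoint W3 & W4] by apply: fW.
have e41 : [disjoint W4 & W1] by apply: fW.
have [_ T1W] := r1; have [_ T2W] := r2; have [_ T3W] := r3; have [_ T4W] := r4.
have l12 : touch W1 W2.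
  by rewrite -{1}eW1; apply: link T2W => //; apply: t1.
have l23 : touch W2 W3 by apply: link T3W => //; apply: t2.
have l34 : touch W3 W4 by apply: link T4W => //; apply: t3.
have l41 : touch W4 W1 by apply: link T1W => //; apply: t4.
clearbody W4 W3 W2 W1.
exists W1, W2, W3, W4; split=> //; split; try by set_solve.
by split; set_solve.
Qed.

(* Potential that each rerouting increases. *)
Definition core_size R B W1 W2 W3 W4 :=
  #|reach (W1 :&: R) T1| + #|reach (W2 :&: B) T2| +
  (#|reach (W3 :&: R) T3| + #|reach (W4 :&: B) T4|).

(** [S'] has to contain only the reachable part of [S], so rerouting may give away the rest of [S]
    without lowering the potential. *)
Lemma reach_grow S S' T x v :
  conn T -> T \subset S -> T \subset S' -> reach S T \subset S' ->
  x \in reach S T -> v \in S' -> v \notin S -> e x v -> #|reach S T| < #|reach S' T|.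
Proof.
move=> cT TS TS' sub xC vS' vS xv; apply: proper_card; apply/properP.
have [/set0Pn[t tT] _] := cT.
have le : reach S T \subset reach S' T.
  apply: (@reach_max _ _ _ t) => //; first exact: conn_reach.
    exact: (subsetP (sub_reach TS)).
  exact: (subsetP (sub_reach TS')).
split=> //; exists v; last by apply: contra vS => /(subsetP (reach_sub _ _)).
by apply: reach_closed xv => //; apply: (subsetP le).
Qed.

Lemma reach_le S S' T :
  conn T -> T \subset S -> T \subset S' -> reach S T \subset S' -> #|reach S T| <= #|reach S' T|.
Proof.
move=> cT TS TS' sub; have [/set0Pn[t tT] _] := cT.
apply: subset_leq_card; apply: (@reach_max _ _ _ t) => //; first exact: conn_reach.
  exact: (subsetP (sub_reach TS)).
exact: (subsetP (sub_reach TS')).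
Qed.

(** The link [R] leaves the core of [W1] into [W2]. Splitting [W2] at [v], and if necessary [W1] at
    the vertex where [B] leaves the core of [W2], either allows a transfer that enlarges a core or
    exhibits a hub around [T4]. *)
Lemma C4_reroute R B W1 W2 W3 W4 x v :
  T1 \subset R -> T3 \subset R -> T2 \subset B -> T4 \subset B ->
  [disjoint R & B] -> conn B ->
  rooted_C4 T1 T2 T3 T4 W1 W2 W3 W4 ->
  x \in reach (W1 :&: R) T1 -> v \in R -> v \in W2 -> e x v ->
  hub T4 T1 T2 T3 \/
  exists W1' W2' W3' W4', rooted_C4 T1 T2 T3 T4 W1' W2' W3' W4' /\
    core_size R B W1 W2 W3 W4 < core_size R B W1' W2' W3' W4'.
Proof.
move=> T1R T3R T2B T4B dRB cB [[r1 r2 r3 r4] dj [t12 t23 t34 t41]] xU vR vW2 xv.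
have [[[c1 s1] [c2 s2]] [[c3 s3] [c4 s4]]] := (r1, r2, (r3, r4)).
have [d12 d13 d14 [d23 d24 d34]] := dj.
have s1R : T1 \subset W1 :&: R by rewrite subsetI s1.
have s2B : T2 \subset W2 :&: B by rewrite subsetI s2.
have s3R : T3 \subset W3 :&: R by rewrite subsetI s3.
have s4B : T4 \subset W4 :&: B by rewrite subsetI s4.
have cU1 := conn_reach cT1 s1R; have cU2 := conn_reach cT2 s2B.
have tU1 := sub_reach s1R; have tU2 := sub_reach s2B.
have U1W : reach (W1 :&: R) T1 \subset W1 :&: R := reach_sub _ _.
have U2W : reach (W2 :&: B) T2 \subset W2 :&: B := reach_sub _ _.
have vB : v \notin B by rewrite (disjointFr dRB vR).
have vT2 : v \notin T2 by apply: contra vB; apply: (subsetP T2B).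
(* The core of [W2] lies in [B] and so avoids [v]; hence it survives in the component [K] around
   [T2]. *)
have [K [cK T2K KW [vK cW [k kK kv] Kmax]]] := cutP c2 cT2 s2 vW2 vT2.
set W := W2 :\: K in cW.
have vW : v \in W by rewrite inE vK.
have WW : W \subset W2 :\: K by [].
have U2K : reach (W2 :&: B) T2 \subset K.
  apply: Kmax => //; first by apply: subset_trans U2W _; apply: subsetIl.
  by apply: contra vB => /(subsetP U2W); rewrite inE => /andP[].
have tKW : touch K W by exists k, v.
have xW1 : x \in W1 by have := subsetP U1W _ xU; rewrite inE => /andP[].
have tW1 : touch W1 W by exists x, v.
have vW1 : v \notin W1 by rewrite (disjointFl d12 vW2).
have eW2 : W2 \subset W :|: K by rewrite /W setDE setUC setUIr setUCr setIT subsetUr.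
clearbody W.
(* If [K] alone still touches [W3], the remainder [W] goes to [W1], whose core gains [v]. *)
have [/touchP tK3|nK3] := boolP (touchb K W3).
  right; exists (W1 :|: W), K, W3, W4; split.
    split; [split=> //; split=> //| split; try (by set_solve); split; set_solve | split=> //].
    - exact: connU.
    - by apply: subset_trans s1 (subsetUl _ _).
    - by apply: touchC; apply: touchS tKW => //; apply: subsetUr.
    - by apply: touchS t41 => //; apply: subsetUl.
  rewrite /core_size ltn_add2r -addSn leq_add //.
    apply: reach_grow xU _ _ xv => //; last by rewrite inE (negbTE vW1).
    - by rewrite subsetI T1R andbT; apply: subset_trans s1 (subsetUl _ _).
    - by set_solve.
    - by rewrite !inE vW orbT.
  by apply: reach_le => //; [rewrite subsetI T2K | set_solve].
have tW3 : touch W W3.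
  have [y [z [yW2 zW3 yz]]] := t23; exists y, z; split=> //.
  have := subsetP eW2 _ yW2; rewrite inE => /orP[//|yK].
  by case/touchP: nK3; exists y, z.
have [/set0Pn[t4 t4T] _] := cT4; have [/set0Pn[t2 t2T] _] := cT2.
have t4B : t4 \in B by apply: (subsetP T4B).
have t4U : t4 \notin reach (W2 :&: B) T2.
  apply/negP=> /(subsetP U2W); rewrite inE => /andP[t4W2 _].
  by have := subsetP s4 _ t4T; rewrite (disjointFr d24 t4W2).
(* Now [W] carries the contact with [W3]. The link [B] is followed from the core of [W2] to the
   first vertex [b] outside; the cases depend on the set that holds [b]. *)
have [y [b [yB yU bB bU yb]]] :=
  conn_exit cB (subsetP T2B _ t2T) (subsetP tU2 _ t2T) t4B t4U.
have bW2 : b \notin W2.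
  by apply: contra bU => bW2; apply: reach_closed yU _ yb; rewrite inE bW2.
have yK := subsetP U2K _ yU.
have yW2 : y \in W2 by apply: (subsetP KW).
have bR : b \notin R by rewrite (disjointFl dRB bB).
have [bW3|bW3] := boolP (b \in W3); first by case/touchP: nK3; exists y, b.
(* In this case [W4] and [W] both touch [W1], [K] and [W3]. A vertex [b] in none of the four sets is
   simply added to [W2]. *)
have [bW4|bW4] := boolP (b \in W4).
  left; exists W4, W, W1, K, W3; split; try by split=> //; apply: touchC.
  - by split; try set_solve; split; set_solve.
  - by split=> //; split; set_solve.
  - by split=> //; [exists b, y; rewrite eC | apply: touchC].
have [bW1|bW1] := boolP (b \in W1); last first.
  right; exists W1, (b |: W2), W3, W4; split.
    have dj1 Z : b \notin Z -> [disjoint W2 & Z] -> [disjoint b |: W2 & Z].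
      by move=> bZ dZ; rewrite disjoints_subset subUset sub1set inE bZ -disjoints_subset.
    split; [split=> //; split|split=> //|split=> //].
    - by rewrite setUC; apply: connU => //; [apply: conn1 | exists y, b; rewrite inE].
    - by apply: subset_trans s2 (subsetUr _ _).
    - by rewrite disjoint_sym dj1 // disjoint_sym.
    - by split=> //; apply: dj1.
    - by apply: touchS t12 => //; apply: subsetUr.
    - by apply: touchS t23 => //; apply: subsetUr.
  rewrite /core_size ltn_add2r ltn_add2l.
  apply: reach_grow yU _ _ yb => //; last by rewrite inE (negbTE bW2).
  - by rewrite subsetI T2B andbT; apply: subset_trans s2 (subsetUr _ _).
  - by apply: subset_trans U2W _; apply: setSI; apply: subsetUr.
  - by rewrite !inE eqxx.
have bT1 : b \notin T1 by apply: contra bR; apply: (subsetP T1R).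
(* The same cut with the two sets exchanged: [b] lies in [B], so the core of [W1] survives in [K'].
   If [K'] still touches [W4], the remainder [W'] goes to [W2]. *)
have [K' [cK' T1K' KW' [bK' cW' [k' k'K k'b] Kmax']]] := cutP c1 cT1 s1 bW1 bT1.
set W' := W1 :\: K' in cW'.
have bW' : b \in W' by rewrite inE bK'.
have WW' : W' \subset W1 :\: K' by [].
have eW1 : W1 \subset W' :|: K' by rewrite /W' setDE setUC setUIr setUCr setIT subsetUr.
clearbody W'.
have U1K : reach (W1 :&: R) T1 \subset K'.
  apply: Kmax' => //; first by apply: subset_trans U1W _; apply: subsetIl.
  by apply: contra bR => /(subsetP U1W); rewrite inE => /andP[].
have tK'W : touch K' W by exists x, v; rewrite (subsetP U1K).
have tKW' : touch K' W' by exists k', b.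
have [/touchP tK4|nK4] := boolP (touchb K' W4).
  right; exists K', (W2 :|: W'), W3, W4; split.
    split; [split=> //; split=> //| split; try (by set_solve); split; set_solve | split=> //].
    - by apply: connU => //; exists y, b.
    - by apply: subset_trans s2 (subsetUl _ _).
    - by apply: touchS tKW' => //; apply: subsetUr.
    - by apply: touchS t23 => //; apply: subsetUl.
    - exact: touchC.
  rewrite /core_size ltn_add2r -addnS leq_add //.
    by apply: reach_le => //; [rewrite subsetI T1K' | set_solve].
  apply: reach_grow yU _ _ yb => //; last by rewrite inE (negbTE bW2).
  - by rewrite subsetI T2B andbT; apply: subset_trans s2 (subsetUl _ _).
  - by set_solve.
  - by rewrite !inE bW' orbT.
have tW'4 : touch W4 W'.
  have [z [w [zW4 wW1 zw]]] := t41; exists z, w; split=> //.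
  have := subsetP eW1 _ wW1; rewrite inE => /orP[//|wK].
  by case/touchP: nK4; exists w, z; rewrite eC.
(* [W'] touches [K] through [b] and [W] touches [K'] through [v], so joining [W'] to [W4] completes
   the hub. *)
left; exists (W4 :|: W'), W, K', K, W3; split.
- by split=> //; split=> //; [apply: connU | apply: subset_trans s4 (subsetUl _ _)].
- by split; try set_solve; split; set_solve.
- by split=> //; split; set_solve.
- split.
  + by apply: touchC; apply: touchS tKW' => //; apply: subsetUr.
  + by exists b, y; rewrite inE bW' orbT eC.
  + by apply: touchC; apply: touchS t34 => //; apply: subsetUl.
- by split=> //; apply: touchC.
Qed.

End FourRoots.

(** * Symmetries and diagonals of rooted four-cycles *)

Lemma C4_reflect T1 T2 T3 T4 W1 W2 W3 W4 :
  rooted_C4 T1 T2 T3 T4 W1 W2 W3 W4 -> rooted_C4 T1 T4 T3 T2 W1 W4 W3 W2.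
Proof.
case=> -[r1 r2 r3 r4] [d12 d13 d14 [d23 d24 d34]] [t12 t23 t34 t41].
split; first by split.
  by split=> //; split; rewrite disjoint_sym.
by split; apply: touchC.
Qed.

Lemma C4_rotate T1 T2 T3 T4 W1 W2 W3 W4 :
  rooted_C4 T1 T2 T3 T4 W1 W2 W3 W4 -> rooted_C4 T2 T3 T4 T1 W2 W3 W4 W1.
Proof.
case=> -[r1 r2 r3 r4] [d12 d13 d14 [d23 d24 d34]] [t12 t23 t34 t41].
split; first by split.
  by split=> //; [rewrite disjoint_sym | split=> //; rewrite disjoint_sym].
by split.
Qed.

Lemma core_size_reflect T1 T2 T3 T4 (R B : {set V}) W1 W2 W3 W4 :
  core_size T1 T4 T3 T2 R B W1 W4 W3 W2 = core_size T1 T2 T3 T4 R B W1 W2 W3 W4.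
Proof. by rewrite /core_size addnACA [RHS]addnACA [X in _ + X]addnC. Qed.

Lemma core_size_rotate T1 T2 T3 T4 (R B : {set V}) W1 W2 W3 W4 :
  core_size T2 T3 T4 T1 B R W2 W3 W4 W1 = core_size T1 T2 T3 T4 R B W1 W2 W3 W4.
Proof. by rewrite /core_size [RHS]addnACA addnACA [X in _ + X]addnC addnC. Qed.

Lemma hub_swap12 T T1 T2 T3 : hub T T1 T2 T3 -> hub T T2 T1 T3.
Proof.
case=> A [U [W1 [W2 [W3 [[r r1 r2 r3] [d1 d2 d3 [d4 d5 d6]] [cU [d7 d8 d9 d10]]]]]]].
case=> t1 t2 t3 [t4 t5 t6]; exists A, U, W2, W1, W3; split=> //.
by split=> //; split=> //; rewrite disjoint_sym.
Qed.

Lemma hub_swap23 T T1 T2 T3 : hub T T1 T2 T3 -> hub T T1 T3 T2.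
Proof.
case=> A [U [W1 [W2 [W3 [[r r1 r2 r3] [d1 d2 d3 [d4 d5 d6]] [cU [d7 d8 d9 d10]]]]]]].
case=> t1 t2 t3 [t4 t5 t6]; exists A, U, W1, W3, W2; split=> //.
by split=> //; split=> //; rewrite disjoint_sym.
Qed.

Definition some_hub T1 T2 T3 T4 :=
  [\/ hub T1 T2 T3 T4, hub T2 T1 T3 T4, hub T3 T1 T2 T4 | hub T4 T1 T2 T3].

(** Let [v] be the vertex through which [R] leaves the core of [W1]. In [W3] it gives the diagonal,
    in [W2] or [W4] it is rerouted (the latter after reflection), and otherwise [W1] absorbs it. *)
Lemma C4_diagonal T1 T2 T3 T4 (R B : {set V}) W1 W2 W3 W4 :
  conn T1 -> conn T2 -> conn T3 -> conn T4 -> conn R -> conn B ->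
  T1 \subset R -> T3 \subset R -> T2 \subset B -> T4 \subset B ->
  [disjoint R & B] ->
  rooted_C4 T1 T2 T3 T4 W1 W2 W3 W4 ->
  [\/ touch W1 W3, some_hub T1 T2 T3 T4 |
  exists W1' W2' W3' W4', rooted_C4 T1 T2 T3 T4 W1' W2' W3' W4' /\
    core_size T1 T2 T3 T4 R B W1 W2 W3 W4 < core_size T1 T2 T3 T4 R B W1' W2' W3' W4'].
Proof.
move=> cT1 cT2 cT3 cT4 cR cB T1R T3R T2B T4B dRB m.
have [[[c1 s1] r2 [c3 s3] r4] [d12 d13 d14 [d23 d24 d34]] [t12 t23 t34 t41]] := m.
have s1R : T1 \subset W1 :&: R by rewrite subsetI s1.
have [/set0Pn[t1 t1T] _] := cT1; have [/set0Pn[t3 t3T] _] := cT3.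
have t3U : t3 \notin reach (W1 :&: R) T1.
  apply/negP=> /(subsetP (reach_sub _ _)); rewrite inE => /andP[t3W1 _].
  by have := subsetP s3 _ t3T; rewrite (disjointFr d13 t3W1).
have [x [v [xR xU vR vU xv]]] := conn_exit cR (subsetP T1R _ t1T)
  (subsetP (sub_reach s1R) _ t1T) (subsetP T3R _ t3T) t3U.
have xW1 : x \in W1 by have := subsetP (reach_sub _ _) _ xU; rewrite inE => /andP[].
have vW1 : v \notin W1.
  by apply: contra vU => vW1; apply: reach_closed xU _ xv; rewrite inE vW1.
have [vW3|vW3] := boolP (v \in W3); first by constructor 1; exists x, v.
have [vW2|vW2] := boolP (v \in W2).
  have [h|] := C4_reroute cT1 cT2 cT4 T1R T3R T2B T4B dRB cB m xU vR vW2 xv.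
    by constructor 2; constructor 4.
  by constructor 3.
have [vW4|vW4] := boolP (v \in W4).
  have m' := C4_reflect m.
  have [h|[X1 [X2 [X3 [X4 [mX]]]]]] :=
    C4_reroute cT1 cT4 cT2 T1R T3R T4B T2B dRB cB m' xU vR vW4 xv.
    by constructor 2; constructor 2; apply: hub_swap23.
  move=> lt; constructor 3; exists X1, X4, X3, X2; split; first exact: C4_reflect.
  by rewrite -(core_size_reflect T1 T2 T3 T4 R B W1) -(core_size_reflect T1 T2 T3 T4 R B X1).
constructor 3; exists (v |: W1), W2, W3, W4; split.
  have dj1 Z : v \notin Z -> [disjoint W1 & Z] -> [disjoint v |: W1 & Z].
    by move=> vZ dZ; rewrite disjoints_subset subUset sub1set inE vZ -disjoints_subset.
  split; [split=> //; split|split=> //; exact: dj1|split=> //].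
  - by rewrite setUC; apply: connU => //; [apply: conn1 | exists x, v; rewrite inE].
  - by apply: subset_trans s1 (subsetUr _ _).
  - by apply: touchS t12 => //; apply: subsetUr.
  - by apply: touchS t41 => //; apply: subsetUr.
rewrite /core_size !ltn_add2r.
apply: reach_grow xU _ _ xv => //; last by rewrite inE (negbTE vW1).
- by rewrite subsetI T1R andbT; apply: subset_trans s1 (subsetUr _ _).
- by apply: subset_trans (reach_sub _ _) _; apply: setSI; apply: subsetUr.
- by rewrite !inE eqxx.
Qed.

(** Induction on the potential, which is bounded because each of the four cores has at most [#|V|]
    vertices. *)
Lemma K4_or_hub T1 T2 T3 T4 (R B : {set V}) W1 W2 W3 W4 :
  conn T1 -> conn T2 -> conn T3 -> conn T4 -> conn R -> conn B ->
  T1 \subset R -> T3 \subset R -> T2 \subset B -> T4 \subset B ->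
  [disjoint R & B] ->
  rooted_C4 T1 T2 T3 T4 W1 W2 W3 W4 ->
  rooted_K4 T1 T2 T3 T4 \/ some_hub T1 T2 T3 T4.
Proof.
move=> cT1 cT2 cT3 cT4 cR cB T1R T3R T2B T4B dRB.
have [n] := ubnP (#|V| + #|V| + (#|V| + #|V|) - core_size T1 T2 T3 T4 R B W1 W2 W3 W4).
elim: n W1 W2 W3 W4 => // n IH W1 W2 W3 W4 le_n m.
have bigger : (exists W1' W2' W3' W4', rooted_C4 T1 T2 T3 T4 W1' W2' W3' W4' /\
    core_size T1 T2 T3 T4 R B W1 W2 W3 W4 < core_size T1 T2 T3 T4 R B W1' W2' W3' W4') ->
    rooted_K4 T1 T2 T3 T4 \/ some_hub T1 T2 T3 T4.
  case=> X1 [X2 [X3 [X4 [mX lt]]]]; apply: IH mX; rewrite -ltnS; apply: leq_trans le_n.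
  rewrite ltnS ltn_sub2l //; apply: leq_trans lt _.
  by rewrite /core_size !leq_add // max_card.
have [t13|h|b] := C4_diagonal cT1 cT2 cT3 cT4 cR cB T1R T3R T2B T4B dRB m;
  [ | by right | exact: bigger b].
have dBR : [disjoint B & R] by rewrite disjoint_sym.
(* Rotating the cycle exchanges [R] and [B] and turns the second diagonal into the first, with the
   same potential. *)
have [t24|h|b] := C4_diagonal cT2 cT3 cT4 cT1 cB cR T2B T4B T3R T1R dBR (C4_rotate m).
- left; case: m => r d [t12 t23 t34 t41].
  by exists W1, W2, W3, W4; split=> //; split=> //; apply: touchC.
- right; case: h => h.
  + by constructor 2; apply: hub_swap12; apply: hub_swap23.
  + by constructor 3; apply: hub_swap12; apply: hub_swap23.
  + by constructor 4; apply: hub_swap12; apply: hub_swap23.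
  + by constructor 1.
- apply: bigger; case: b => X1 [X2 [X3 [X4 [mX lt]]]].
  exists X4, X1, X2, X3; split; first by do 3!apply: C4_rotate.
  by rewrite -(core_size_rotate T1 T2 T3 T4 R B W1) -(core_size_rotate T1 T2 T3 T4 R B X4).
Qed.

(** * Recoloring *)

(** What recoloring preserves of a Kempe coloring: disjoint classes [A i], connected root sets in
    them, and a link for each pair of classes. Root sets are not single vertices because recoloring
    enlarges them. *)
Definition link_system (I : finType) (A T : I -> {set V}) :=
  [/\ forall i, conn (T i), forall i, T i \subset A i,
      forall i j, i != j -> [disjoint A i & A j] &
      forall i j, i != j ->
        exists Z, [/\ conn Z, T i \subset Z, T j \subset Z & Z \subset A i :|: A j]].

Definition rooted_clique (I : finType) (T : I -> {set V}) :=
  exists W : I -> {set V}, (forall i, rooted (T i) (W i)) /\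
    (forall i j, i != j -> [disjoint W i & W j] /\ touch (W i) (W j)).

Definition larger_system (I : finType) (T : I -> {set V}) :=
  exists A' T' : I -> {set V}, [/\ link_system A' T', forall i, T i \subset T' i &
    exists i, T i \proper T' i].

Section Recolor.
Variables (I : finType) (A T : I -> {set V}).

(* The vertex p joins X to form the new root set; every link between two other classes can avoid X
   because it could only leave X through q. *)
Lemma recolor_system j X p q :
  link_system A T -> conn X -> T j \subset X ->
  (forall m, m != j -> [disjoint X & T m]) ->
  p \notin X -> p \in A j -> touch [set p] X ->
  (forall u v, u \in X -> v \notin X -> e u v -> v = p \/ v = q) ->
  larger_system T.
Proof.
move=> [cT TA dA link] cX TX dX pX pA tpX NX; set Y := p |: X.
have cY : conn Y by apply: connU => //; apply: conn1.
have pm m : m != j -> p \notin A m by move=> mj; rewrite (disjointFl (dA m j mj)).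
have TY m : m != j -> [disjoint T m & Y].
  move=> mj; rewrite disjoint_sym disjoints_subset subUset sub1set inE.
  by rewrite -disjoints_subset dX // andbT; apply: contra (pm m mj); apply: (subsetP (TA m)).
have TjY : T j \subset Y by apply: subset_trans TX (subsetUr _ _).
pose A' m := if m == j then A j :|: Y else A m :\: Y.
pose T' m := if m == j then Y else T m.
have link_j m : m != j -> exists Z, [/\ conn Z, Y \subset Z, T m \subset Z & Z \subset A' j :|: A' m].
  move=> mj; have [Z [cZ jZ mZ ZA]] := link m j mj.
  have [/set0Pn[t tT] _] := cT j.
  exists (Z :|: Y); split; last by rewrite /A' eqxx (negbTE mj); clear -ZA; set_solve.
  - by apply: connU_meet cZ cY _ _; [apply: (subsetP mZ t) | apply: (subsetP TjY)].
  - exact: subsetUr.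
  - by apply: subset_trans jZ (subsetUl _ _).
exists A', T'; split; [split | | ].
- by move=> m; rewrite /T'; case: eqP.
- move=> m; rewrite /T' /A'; case: ifP => [_|/negbT mj]; first exact: subsetUr.
  by rewrite subsetD TA TY.
- move=> m n mn; rewrite /A'; case: (eqVneq m j) => [mj|mj]; case: (eqVneq n j) => [nj|nj].
  + by rewrite mj nj eqxx in mn.
  + have := dA j n; rewrite eq_sym => /(_ nj); clear; move=> d; set_solve.
  + have := dA j m; rewrite eq_sym => /(_ mj); clear; move=> d; set_solve.
  + by have := dA m n mn; clear; move=> d; set_solve.
- move=> m n mn; rewrite /T'; case: (eqVneq m j) => [mj|mj]; case: (eqVneq n j) => [nj|nj].
  + by rewrite mj nj eqxx in mn.
  + by have [Z [? ? ? ?]] := link_j _ nj; exists Z; rewrite mj.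
  + by have [Z [cZ ? ? ZA]] := link_j _ mj; exists Z; rewrite nj setUC.
  have [Z [cZ mZ nZ ZA]] := link m n mn.
  have pZ : p \notin Z.
    by apply/negP=> /(subsetP ZA); rewrite inE (negbTE (pm m mj)) (negbTE (pm n nj)).
  have sX l : l != j -> T l \subset Z -> T l \subset Z :\: X.
    by move=> lj lZ; rewrite subsetD lZ disjoint_sym dX.
  exists (Z :\: X); split; [ | exact: sX | exact: sX | ].
    apply: (@conn_setD Z X q) => //.
      have [/set0Pn[t tT] _] := cT m.
      by apply/set0Pn; exists t; apply: (subsetP (sX m mj mZ)).
    move=> u v uX vZ vX uv; have [vp|//] := NX u v uX vX uv.
    by rewrite -vp vZ in pZ.
  rewrite /A' (negbTE mj) (negbTE nj); apply/subsetP=> z; rewrite !inE => /andP[zX zZ].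
  have /norP[zp _] : ~~ ((z == p) || false) by rewrite orbF; apply: contraNneq pZ => <-.
  by have := subsetP ZA z zZ; rewrite inE (negbTE zp) (negbTE zX).
- by move=> m; rewrite /T'; case: eqP => // ->.
- exists j; rewrite /T' eqxx properE TjY; apply/subsetPn; exists p.
    by rewrite !inE eqxx.
  by apply: contra pX; apply: (subsetP TX).
Qed.

End Recolor.

(** * The rooted K4 theorem *)

Section FourIndices.
Implicit Types (i j k l m n : 'I_4) (H U : {set V}).

Lemma no_five_ord4 i j k l m : ~ uniq [:: i; j; k; l; m].
Proof. by move=> u; have := max_card [in [:: i; j; k; l; m]]; rewrite (card_uniqP u) card_ord. Qed.

Lemma fourth_ord4 i j k : uniq [:: i; j; k] ->
  exists2 l, uniq [:: i; j; k; l] & forall m, m \in [:: i; j; k; l].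
Proof.
move=> u.
have [l lP] : exists l, l \notin [:: i; j; k].
  apply/existsP; rewrite -negb_forall; apply/negP=> /forallP all_in.
  have : #|'I_4| <= #|[in [:: i; j; k]]| by apply: subset_leq_card; apply/subsetP=> m _.
  by rewrite card_ord (card_uniqP u).
have u4 : uniq [:: i; j; k; l].
  by rewrite (_ : [:: i; j; k; l] = rcons [:: i; j; k] l) // rcons_uniq lP.
exists l => // m; apply: contraT => mP; case: (@no_five_ord4 m i j k l).
by rewrite cons_uniq mP.
Qed.

Lemma rooted_K4_clique (T : 'I_4 -> {set V}) i j k l :
  uniq [:: i; j; k; l] -> rooted_K4 (T i) (T j) (T k) (T l) -> rooted_clique T.
Proof.
move=> u [Wi [Wj [Wk [Wl [[ri rj rk rl] [dij dik dil [djk djl dkl]]]]]]].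
move=> [tij tik til] [tjk tjl tkl].
have all4 m : m \in [:: i; j; k; l].
  by apply: contraT => mP; case: (@no_five_ord4 m i j k l); rewrite cons_uniq mP.
move: u; rewrite /= !inE !negb_or andbT => /and3P[/and3P[ij ik il] /andP[jk jl] kl].
pose W m := if m == i then Wi else if m == j then Wj else if m == k then Wk else Wl.
have Ei : W i = Wi by rewrite /W eqxx.
have Ej : W j = Wj by rewrite /W eq_sym (negbTE ij) eqxx.
have Ek : W k = Wk by rewrite /W eq_sym (negbTE ik) eq_sym (negbTE jk) eqxx.
have El : W l = Wl.
  by rewrite /W eq_sym (negbTE il) eq_sym (negbTE jl) eq_sym (negbTE kl).
exists W; split=> [m|m n].
  by have := all4 m; rewrite !inE => /or4P[] /eqP->; rewrite ?Ei ?Ej ?Ek ?El.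
have dsym (X Y : {set V}) : [disjoint X & Y] /\ touch X Y -> [disjoint Y & X] /\ touch Y X.
  by case=> d t; split; [rewrite disjoint_sym | apply: touchC].
have := all4 m; rewrite !inE => /or4P[] /eqP->;
have := all4 n; rewrite !inE => /or4P[] /eqP->;
by rewrite ?Ei ?Ej ?Ek ?El ?eqxx // => _; try apply: dsym; split.
Qed.

(** * Reduction of hubs *)

Variables (A T : 'I_4 -> {set V}).
Hypothesis sysT : link_system A T.

(** [hub_model] with the satellites collected into a family, so that one argument covers all three;
    only the values of [M] off [i] are constrained. *)
Definition hub_at i H U (M : 'I_4 -> {set V}) :=
  [/\ rooted (T i) H, conn U /\ [disjoint H & U],
      forall m, m != i -> [/\ rooted (T m) (M m), [disjoint H & M m], [disjoint U & M m],
                              touch H (M m) & touch U (M m)] &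
      forall m n, m != i -> n != i -> m != n -> [disjoint M m & M n]].

Definition set_satellite (M : 'I_4 -> {set V}) m X : 'I_4 -> {set V} :=
  fun n => if n == m then X else M n.

Lemma hub_hub_at i j k l :
  uniq [:: i; j; k; l] -> hub (T i) (T j) (T k) (T l) ->
  exists H U (M : 'I_4 -> {set V}), hub_at i H U M.
Proof.
move=> u [H [U [Wj [Wk [Wl [[ri rj rk rl] [dij dik dil [djk djl dkl]]]]]]]].
move=> [cU [d d1 d2 d3]] [t1 t2 t3] [t4 t5 t6].
have all4 m : m \in [:: i; j; k; l].
  by apply: contraT => mP; case: (@no_five_ord4 m i j k l); rewrite cons_uniq mP.
move: u; rewrite /= !inE !negb_or andbT => /and3P[/and3P[ij ik il] /andP[jk jl] kl].
pose M m := if m == j then Wj else if m == k then Wk else Wl.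
have Ej : M j = Wj by rewrite /M eqxx.
have Ek : M k = Wk by rewrite /M eq_sym (negbTE jk) eqxx.
have El : M l = Wl by rewrite /M eq_sym (negbTE jl) eq_sym (negbTE kl).
exists H, U, M; split=> // [m|m n].
  by have := all4 m; rewrite !inE => /or4P[] /eqP->; rewrite ?eqxx ?Ej ?Ek ?El.
have := all4 m; rewrite !inE => /or4P[] /eqP->;
have := all4 n; rewrite !inE => /or4P[] /eqP->;
by rewrite ?eqxx ?Ej ?Ek ?El // 1?disjoint_sym.
Qed.

(** [U] touches both [M m] and [M n]. Joined to the third satellite it supplies the two missing
    contacts. *)
Lemma hub_touch_clique i H U M m n :
  hub_at i H U M -> m != i -> n != i -> m != n -> touch (M m) (M n) ->
  rooted_clique T.
Proof.
move=> [rH [cU dHU] hW dW] mi ni mn tmn.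
have [|l u all4] := @fourth_ord4 i m n.
  by rewrite /= !inE negb_or andbT eq_sym mi eq_sym ni mn.
have : uniq [:: i; m; n; l] by [].
rewrite /= !inE !negb_or andbT => /and3P[/and3P[_ _ il] /andP[_ ml] nl].
have li : l != i by rewrite eq_sym.
apply: (rooted_K4_clique u).
have [rm dm dUm tm tUm] := hW m mi; have [rn dn dUn tn tUn] := hW n ni.
have [[cl sl] dl dUl tl tUl] := hW l li.
have d1 := dW m n mi ni mn; have d2 := dW m l mi li ml; have d3 := dW n l ni li nl.
exists H, (M m), (M n), (M l :|: U); split.
- split=> //; split; last by apply: subset_trans sl (subsetUl _ _).
  by apply: connU => //; apply: touchC.
- move: (M m) (M n) (M l) dm dn dl dUm dUn dUl d1 d2 d3 => Wm Wn Wl *.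
  by split; try set_solve; split; set_solve.
- by split=> //; apply: touchS tl => //; apply: subsetUl.
- by split=> //; apply: touchC; [apply: touchS tUm | apply: touchS tUn] => //; apply: subsetUr.
Qed.

Lemma hub_shrink i H U M H' U' m x :
  hub_at i H U M -> m != i ->
  H' \subset H -> U' \subset U -> rooted (T i) H' -> conn U' ->
  x \in H :|: U -> x \notin H' :|: U' ->
  (forall n, n != i -> n != m -> touch H' (M n) /\ touch U' (M n)) ->
  touch [set x] (M m) -> touch H' (x |: M m) -> touch U' (x |: M m) ->
  hub_at i H' U' (set_satellite M m (x |: M m)).
Proof.
move=> [rH [cU dHU] hW dW] mi sH sU rH' cU' xHU xHU' tn tx tHx tUx.
have xW n : n != i -> x \notin M n.
  move=> ni; have [_ d1 d2 _ _] := hW n ni; move: xHU; rewrite inE.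
  by case/orP=> xX; [rewrite (disjointFr d1 xX) | rewrite (disjointFr d2 xX)].
have dxW n : n != i -> n != m -> [disjoint x |: M m & M n].
  move=> ni nm; rewrite disjoints_subset subUset sub1set inE xW //=.
  by rewrite -disjoints_subset dW // eq_sym.
move: xHU'; rewrite inE negb_or => /andP[xH' xU'].
have dX n Y : n != i -> x \notin Y -> [disjoint Y & M n] -> [disjoint Y & x |: M n].
  move=> ni xY dY; rewrite disjoint_sym disjoints_subset subUset sub1set inE xY /=.
  by rewrite -disjoints_subset disjoint_sym.
split=> //; first by split=> //; apply: disjointW dHU.
  move=> n ni; have [[conn_ sn] d1 d2 t1 t2] := hW n ni; rewrite /set_satellite.
  have d1' := disjointWl sH d1; have d2' := disjointWl sU d2.
  case: eqP => [nm|/eqP nm]; last by have [? ?] := tn n ni nm.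
  rewrite -nm in tx tHx tUx *; split=> //; try exact: dX.
  split; last by apply: subset_trans sn (subsetUr _ _).
  by apply: connU => //; apply: conn1.
move=> n n' ni n'i nn'; rewrite /set_satellite.
case: eqP => [nm|/eqP nm]; case: eqP => [n'm|/eqP n'm]; last exact: dW.
- by rewrite nm n'm eqxx in nn'.
- exact: dxW.
- by rewrite disjoint_sym dxW.
Qed.

Lemma conn_touch_D1 Y x : conn Y -> x \in Y -> conn (Y :\ x) -> touch [set x] (Y :\ x).
Proof.
move=> cY xY [/set0Pn[y yY] _]; move: (yY); rewrite !inE => /andP[yx yY'].
have [|| u [v [_ /set1P-> vY vx xv]]] := @conn_exit Y [set x] x y cY xY _ yY'.
- by rewrite inE.
- by rewrite inE.
by rewrite inE in vx; exists x, v; rewrite !inE vx.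
Qed.

Definition smaller_hub i H U :=
  exists H' U' (M' : 'I_4 -> {set V}),
    hub_at i H' U' M' /\ #|H'| + #|U'| < #|H| + #|U|.

(* If only one satellite loses contact with the hub, x moves to that satellite. *)
Lemma hub_private i H U M Y x :
  hub_at i H U M -> (Y = H /\ T i \subset H :\ x) \/ Y = U ->
  x \in Y -> conn (Y :\ x) ->
  smaller_hub i H U \/
  (exists m n, [/\ m != i, n != i, m != n,
     ~ touch (Y :\ x) (M m) & ~ touch (Y :\ x) (M n)]).
Proof.
move=> hub_H HU xY cY; have [rH [cU dHU] hW dW] := hub_H.
have [/existsP[m /existsP[n /and5P[mi ni mn /touchP nm /touchP nn]]]|nex] := boolP
  [exists m, exists n, [&& m != i, n != i, m != n, ~~ touchb (Y :\ x) (M m) & ~~ touchb (Y :\ x) (M n)]].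
  by right; exists m, n.
left.
have uniqp m n : m != i -> n != i -> ~ touch (Y :\ x) (M m) -> n != m -> touch (Y :\ x) (M n).
  move=> mi ni nm mn; apply/touchP; apply: contraT => nn; case/negP: nex.
  apply/existsP; exists m; apply/existsP; exists n; rewrite mi ni eq_sym mn nn andbT.
  exact/touchP.
have xHU : x \in H :|: U by rewrite inE; case: HU => [[<- _]|<-]; rewrite xY ?orbT.
(* Common to [H] and [U]: if every satellite keeps contact, [x] is dropped; if exactly one loses it,
   that satellite receives [x]. *)
have key H' U' : H' \subset H -> U' \subset U -> rooted (T i) H' -> conn U' ->
    x \notin H' :|: U' -> #|H'| + #|U'| < #|H| + #|U| ->
    (forall n, n != i -> touch (Y :\ x) (M n) -> touch H' (M n) /\ touch U' (M n)) ->
    (forall m, m != i -> ~ touch (Y :\ x) (M m) ->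
       [/\ touch [set x] (M m), touch H' (x |: M m) & touch U' (x |: M m)]) ->
    smaller_hub i H U.
  move=> sH sU rH' cU' xHU' lt tn tm.
  have [/existsP[m /andP[mi /touchP nm]]|nem] := boolP [exists m, (m != i) && ~~ touchb (Y :\ x) (M m)].
    have [t1 t2 t3] := tm m mi nm.
    exists H', U', (set_satellite M m (x |: M m)); split=> //.
    apply: (hub_shrink hub_H mi sH sU) => // n ni nm'.
    by apply: tn => //; apply: uniqp nm _.
  exists H', U', M; split=> //; split=> //; first by split=> //; apply: disjointW dHU.
  move=> n ni; have [rn d1 d2 _ _] := hW n ni.
  have [t1 t2] : touch H' (M n) /\ touch U' (M n).
    apply: tn => //; apply/touchP; apply: contraT => nt; case/negP: nem.
    by apply/existsP; exists n; rewrite ni.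
  by split=> //; [apply: disjointWl d1 | apply: disjointWl d2].
have lost m : touch Y (M m) -> ~ touch (Y :\ x) (M m) -> touch [set x] (M m).
  case=> u [v [uY vW uv]] nt; exists u, v; split=> //; rewrite inE; apply: contraT => ux.
  by case: nt; exists u, v; rewrite !inE ux.
have gain Z m : touch Z (M m) -> touch Z (x |: M m).
  by move=> t; apply: touchS t => //; apply: subsetUr.
have near m : conn Y -> touch (Y :\ x) (x |: M m).
  by move=> cY'; apply: touchC; apply: touchS (conn_touch_D1 cY' xY cY) => //; apply: subsetUl.
case: HU => [[YH TH]|YU]; subst Y.
  apply: (key (H :\ x) U) => //; first exact: subD1set.
  - by rewrite !inE eqxx (disjointFr dHU xY).
  - by rewrite ltn_add2r [X in _ < X](cardsD1 x) xY.
  - by move=> n ni t; have [_ _ _ _ t2] := hW n ni.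
  - move=> m mi nt; have [_ _ _ t1 t2] := hW m mi.
    by split; [apply: lost | apply: near; case: rH | apply: gain].
apply: (key H (U :\ x)) => //; first exact: subD1set.
- by rewrite !inE eqxx (disjointFl dHU xY).
- by rewrite ltn_add2l [X in _ < X](cardsD1 x) xY.
- by move=> n ni t; have [_ _ _ t1 _] := hW n ni.
- move=> m mi nt; have [_ _ _ t1 t2] := hW m mi.
  by split; [apply: lost | apply: gain | apply: near].
Qed.
Definition closed_in (X Y : {set V}) :=
  forall u v, u \in X -> v \notin X -> e u v -> v \in Y.

(** The satellite is enlarged to all it reaches outside the hub and the other satellites. An edge
    from it to another satellite yields the clique by [hub_touch_clique]; every other outgoing edge
    ends in the hub. *)
Lemma hub_close1 i H U M m :
  hub_at i H U M -> m != i ->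
  rooted_clique T \/ exists X, hub_at i H U (set_satellite M m X) /\ closed_in X (H :|: U).
Proof.
move=> hub_H mi; have [rH [cU dHU] hW dW] := hub_H.
pose N := \bigcup_(n | (n != i) && (n != m)) M n.
have [[cM sM] dHM dUM tH tU] := hW m mi.
have dMN n : n != i -> n != m -> M n \subset N.
  by move=> ni nm; apply: (bigcup_sup n) => //; rewrite ni nm.
have sMS : M m \subset ~: (H :|: U :|: N).
  have dN : [disjoint M m & N].
    by apply/bigcup_disjointP=> n /andP[ni nm]; rewrite dW // eq_sym.
  apply/subsetP=> z zM; rewrite !inE !negb_or.
  by rewrite (disjointFl dHM zM) (disjointFl dUM zM) (disjointFr dN zM).
set S := ~: _ in sMS; pose X := reach S (M m).
have sMX : M m \subset X by apply: sub_reach.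
have XS : X \subset S by apply: reach_sub.
have dX Y : Y \subset H :|: U :|: N -> [disjoint Y & X].
  move=> sY; rewrite disjoint_sym disjoints_subset; apply: subset_trans XS _.
  by rewrite setCS.
have dXn n : n != i -> n != m -> [disjoint M n & X].
  by move=> ni nm; apply: dX; apply: subset_trans (dMN n ni nm) (subsetUr _ _).
have hub_X : hub_at i H U (set_satellite M m X).
  split=> // [n ni|n n' ni n'i nn']; rewrite /set_satellite.
    case: eqP => [->|_]; last exact: hW.
    split.
    - by split; [apply: conn_reach | apply: subset_trans sM sMX].
    - by apply: dX; rewrite -setUA subsetUl.
    - by apply: dX; rewrite -setUA setUCA subsetUl.
    - exact: touchS tH.
    - exact: touchS tU.
  case: (eqVneq n m) => [nm|nm]; case: (eqVneq n' m) => [n'm|n'm].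
  - by rewrite nm n'm eqxx in nn'.
  - by rewrite disjoint_sym dXn.
  - exact: dXn.
  - exact: dW.
have [/existsP[n /and3P[ni nm /touchP t]]|nt] :=
  boolP [exists n, [&& n != i, n != m & touchb X (M n)]].
  left; apply: (hub_touch_clique hub_X mi ni); first by rewrite eq_sym.
  by rewrite /set_satellite eqxx (negbTE nm).
right; exists X; split=> // u v uX vX uv; apply: contraT => vHU.
have : v \notin S by apply: contra vX => vS; apply: reach_closed uX vS uv.
rewrite inE negbK inE (negbTE vHU) /= => /bigcupP[n /andP[ni nm] vn].
case/negP: nt; apply/existsP; exists n; rewrite ni nm /=.
by apply/touchP; exists u, v.
Qed.

Lemma hub_close i H U M :
  hub_at i H U M ->
  rooted_clique T \/
  exists M', hub_at i H U M' /\ forall m, m != i -> closed_in (M' m) (H :|: U).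
Proof.
move=> hubM; suff: rooted_clique T \/ exists M', hub_at i H U M' /\
    forall m, m \in enum 'I_4 -> m != i -> closed_in (M' m) (H :|: U).
  case=> [|[M' [hM' cM']]]; [by left|right; exists M'; split=> // m].
  by apply: cM'; rewrite mem_enum.
elim: (enum _) => [|m s IH]; first by right; exists M.
case: IH => [|[M' [hM' cM']]]; first by left.
have [mi|mi] := eqVneq m i.
  right; exists M'; split=> // n; rewrite inE => /orP[/eqP->|]; last exact: cM'.
  by rewrite mi eqxx.
have [|[X [hX cX]]] := hub_close1 hM' mi; [by left|right].
exists (set_satellite M' m X); split=> // n ns ni; rewrite /set_satellite; case: eqP => // /eqP nm.
by apply: cM' => //; move: ns; rewrite inE (negbTE nm).
Qed.

(** A satellite whose only contact in [U] is [x] cannot have only [y]. The four satellites named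
    would then be distinct, but there are three. *)
Lemma card2_private i H U M x y m n m' n' :
  hub_at i H U M -> x != y ->
  [/\ m != i, n != i, m != n, ~ touch (U :\ x) (M m) & ~ touch (U :\ x) (M n)] ->
  [/\ m' != i, n' != i, m' != n', ~ touch (U :\ y) (M m') & ~ touch (U :\ y) (M n')] ->
  False.
Proof.
move=> [_ _ hM _] xy [mi ni mn xm xn] [m'i n'i m'n' ym yn].
have E k k' : k != i -> ~ touch (U :\ x) (M k) -> ~ touch (U :\ y) (M k') -> k != k'.
  move=> ki xk yk; apply/eqP=> kk'; rewrite -kk' in yk.
  have [_ _ _ _ [u [v [uU vM uv]]]] := hM k ki.
  have [ux|ux] := eqVneq u x; last by case: xk; exists u, v; rewrite !inE ux.
  by case: yk; exists u, v; rewrite !inE ux xy -ux.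
apply: (@no_five_ord4 i m n m' n').
rewrite /= !inE !negb_or ![i == _]eq_sym mi ni m'i n'i mn m'n'.
by rewrite (E m m') ?(E m n') ?(E n m') ?(E n n').
Qed.

(** After the satellites are closed, a hub that cannot be made smaller has a single vertex [u] in
    [U] and a vertex [x] of [H] on which two satellites depend; the link between these leaves one of
    them through [x] or [u], and that vertex is recolored. *)
Lemma hub_step i H U M :
  hub_at i H U M -> [\/ rooted_clique T, larger_system T | smaller_hub i H U].
Proof.
case/hub_close=> [|[{}M [hubM cM]]]; first by constructor 1.
have [[cH sH] [cU dHU] hM dM] := hubM; have [cT TA dA link] := sysT.
have [/set0Pn[u uU] _] := cU.
(* Otherwise [U] has two non-cut vertices. If neither allows a smaller hub, each is the only contact
   of two satellites, contrary to [card2_private]. *)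
have [eU|neU] := eqVneq U [set u]; last first.
  have prop x : x \in U -> [set x] \proper U.
    move=> xU; rewrite properEneq sub1set xU andbT; apply: contraNneq neU => E.
    by rewrite -E in uU *; move/set1P: uU => ->.
  have [x [xU _ cx]] := noncut cU (conn1 u) (prop u uU).
  have [y [yU + cy]] := noncut cU (conn1 x) (prop x xU).
  rewrite inE eq_sym => xy.
  have [|[m [n mn]]] := hub_private hubM (or_intror erefl) xU cx.
    by constructor 3.
  have [|[m' [n' mn']]] := hub_private hubM (or_intror erefl) yU cy.
    by constructor 3.
  by case: (card2_private hubM xy mn mn').
(* By closure, the link between two satellites can leave [M j] only into the hub. *)
have exit j k : j != i -> k != i -> j != k -> exists p,
    [/\ p \in A j :|: A k, p \notin M j, p \in H :|: U & touch [set p] (M j)].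
  move=> ji ki jk; have [Z [cZ jZ kZ ZA]] := link j k jk.
  have [/set0Pn[a aj] _] := cT j; have [/set0Pn[b bk] _] := cT k.
  have [[_ sj] _ _ _ _] := hM j ji; have [[_ sk] _ _ _ _] := hM k ki.
  have aM := subsetP sj a aj.
  have bM : b \notin M j by rewrite (disjointFl (dM j k ji ki jk)) // (subsetP sk).
  have [v [p [_ vM pZ pM vp]]] := conn_exit cZ (subsetP jZ a aj) aM (subsetP kZ b bk) bM.
  exists p; split=> //; [exact: (subsetP ZA)|exact: cM vM pM vp|].
  by exists p, v; rewrite inE eC.
(* If [H] is just the root set, it lies in [A i], so each exit vertex is [u]. Then [u] would lie in
   the union of any two of three disjoint classes, which is impossible. *)
have [eH|neH] := eqVneq (T i) H.
  have inA j k : j != i -> k != i -> j != k -> u \in A j :|: A k.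
    move=> ji ki jk; have [p [pA _ pHU _]] := exit j k ji ki jk.
    move: pHU; rewrite -eH eU in_setU in_set1 => /orP[pT|/eqP <-//].
    have pi := subsetP (TA i) p pT; move: pA; rewrite inE.
    by rewrite (disjointFl (dA j i ji) pi) (disjointFl (dA k i ki) pi).
  have oi (m : 'I_3) : lift i m != i :> 'I_4 by rewrite eq_sym neq_lift.
  have oo (m m' : 'I_3) : m != m' -> lift i m != lift i m' by rewrite (inj_eq lift_inj).
  pose o0 := @Ordinal 3 0 isT; pose o1 := @Ordinal 3 1 isT; pose o2 := @Ordinal 3 2 isT.
  have p : lift i o0 != lift i o1 by apply: oo.
  have q : lift i o0 != lift i o2 by apply: oo.
  have r : lift i o1 != lift i o2 by apply: oo.
  have := inA _ _ (oi o0) (oi o1) p; have := inA _ _ (oi o0) (oi o2) q.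
  have := inA _ _ (oi o1) (oi o2) r.
  have := dA _ _ p; have := dA _ _ q; have := dA _ _ r.
  move: (A (lift i o0)) (A (lift i o1)) (A (lift i o2)) => Aj Ak Al.
  move=> /disjP/(_ u) + /disjP/(_ u) + /disjP/(_ u).
  by rewrite !inE; case: (u \in Aj); case: (u \in Ak); case: (u \in Al).
have [|x [xH xT cx]] := noncut cH (cT i); first by rewrite properEneq neH.
have TH : T i \subset H :\ x by rewrite subsetD1 sH.
have [|[j [k [ji ki jk nj nk]]]] := hub_private hubM (or_introl (conj erefl TH)) xH cx.
  by constructor 3.
have nbr l v w : l != i -> ~ touch (H :\ x) (M l) -> v \in M l -> w \in H :|: U -> e v w ->
    w = x \/ w = u.
  move=> li nl vl; rewrite eU !inE => /orP[wH|/eqP]; last by right.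
  move=> vw; left; apply/eqP; apply: contraT => wx.
  by case: nl; exists w, v; rewrite !inE wx eC.
have tx l : l != i -> ~ touch (H :\ x) (M l) -> touch [set x] (M l).
  move=> li nl; have [_ _ _ [w [v [wH vM wv]]] _] := hM l li.
  exists w, v; split=> //; rewrite inE; apply: contraT => wx.
  by case: nl; exists w, v; rewrite !inE wx.
have [p [pA pM pHU tp]] := exit j k ji ki jk.
have pxu : p = x \/ p = u.
  have [p' [v [/set1P-> vM pv]]] := tp.
  by apply: (nbr j v) => //; rewrite eC.
(* Here [l] is the one of [j] and [k] whose class contains [p]; the other vertex of [x] and [u] is
   the second possible exit from [M l]. *)
have recolor l : l != i -> ~ touch (H :\ x) (M l) -> p \in A l -> larger_system T.
  move=> li nl pl; have [[cMl sl] dHl dUl _ tUl] := hM l li.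
  apply: (@recolor_system _ A T l (M l) p (if p == x then u else x)) => //.
  - move=> m ml; have [->|mi] := eqVneq m i.
      by rewrite disjoint_sym; apply: disjointWl dHl.
    have [[_ sm] _ _ _ _] := hM m mi; apply: disjointWr sm _.
    by apply: dM => //; rewrite eq_sym.
  - by case/setUP: pHU => pX; [rewrite (disjointFr dHl pX)|rewrite (disjointFr dUl pX)].
  - by case: pxu => ->; [apply: tx|rewrite -eU].
  - move=> v w vM wM vw; have := nbr l v w li nl vM (cM l li v w vM wM vw) vw.
    by case: pxu => ->; [rewrite eqxx | case: eqP => [->|_]; tauto].
by constructor 2; case/setUP: pA => pA; [apply: (recolor j)|apply: (recolor k)].
Qed.

Lemma hub_resolve i H U M :
  hub_at i H U M -> rooted_clique T \/ larger_system T.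
Proof.
have [n] := ubnP (#|H| + #|U|); elim: n H U M => // n IH H U M le_n.
case/hub_step=> [||[H' [U' [M' [hub' lt]]]]]; [by left|by right|].
by apply: IH hub'; apply: leq_trans lt _.
Qed.

End FourIndices.

(** Induction on the number of vertices missing from the root sets, since a clique for larger roots
    is one for [T]. Links over disjoint pairs of classes are disjoint, as the four-cycle and its
    diagonals require. *)
Theorem rooted_clique_of_links (A T : 'I_4 -> {set V}) : link_system A T -> rooted_clique T.
Proof.
have [n] := ubnP (\sum_i (#|V| - #|T i|)); elim: n A T => // n IH A T le_n sysT.
have [cT TA dA link] := sysT.
pose i := @Ordinal 4 0 isT; pose j := @Ordinal 4 1 isT.
pose k := @Ordinal 4 2 isT; pose l := @Ordinal 4 3 isT.
have above : larger_system T -> rooted_clique T.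
  case=> A' [T' [sys' TT' [m mT]]].
  have [|W [rW dW]] := IH A' T' _ sys'; last first.
    exists W; split=> // m'; have [cW sW] := rW m'.
    by split=> //; apply: subset_trans (TT' m') sW.
  rewrite -ltnS; apply: leq_trans le_n; rewrite ltnS (bigD1 m) // [X in _ < X](bigD1 m) //=.
  rewrite -addSn leq_add //.
    by rewrite ltn_sub2l ?(proper_card mT) // (leq_trans (proper_card mT)) ?max_card.
  by apply: leq_sum => m' _; rewrite leq_sub2l ?subset_leq_card.
have hubs a b c d : uniq [:: a; b; c; d] -> hub (T a) (T b) (T c) (T d) -> rooted_clique T.
  by move=> u /(hub_hub_at u)[H [U [M hubM]]]; case: (hub_resolve sysT hubM).
have [Xij [cij iij jij Aij]] := link i j isT; have [Xjk [cjk jjk kjk Ajk]] := link j k isT.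
have [Xkl [ckl kkl lkl Akl]] := link k l isT; have [Xli [cli lli ili Ali]] := link l i isT.
have [R [cR iR kR RA]] := link i k isT; have [B [cB jB lB BA]] := link j l isT.
have disj a b c d X Y : X \subset A a :|: A b -> Y \subset A c :|: A d ->
    a != c -> a != d -> b != c -> b != d -> [disjoint X & Y].
  move=> XA YA /dA d1 /dA d2 /dA d3 /dA d4.
  by move: (A a) (A b) (A c) (A d) XA YA d1 d2 d3 d4 => *; set_solve.
have d1 : [disjoint Xij & Xkl] by apply: disj Aij Akl _ _ _ _.
have d2 : [disjoint Xjk & Xli] by apply: disj Ajk Ali _ _ _ _.
have d3 : [disjoint R & B] by apply: disj RA BA _ _ _ _.
have [W1 [W2 [W3 [W4 m]]]] := C4_of_links (cT i) (cT j) (cT k) (cT l)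
  cij cjk ckl cli iij jij jjk kjk kkl lkl lli ili d1 d2.
have [K|] := K4_or_hub (cT i) (cT j) (cT k) (cT l) cR cB iR kR jB lB d3 m.
  exact: (@rooted_K4_clique T i j k l).
by case; [apply: (hubs i j k l) | apply: (hubs j i k l) | apply: (hubs k i j l) |
  apply: (hubs l i j k)].
Qed.

(** * Splitting a connected set *)

Section Split.
Variables (B N : {set V}) (cl : V -> {set V}).
Hypotheses (cl_refl : forall z, z \in cl z)
  (cl_eq : forall z y, y \in cl z -> cl y = cl z)
  (cl_cn : forall z, z \in B -> conn (cl z))
  (cl_sub : forall z, z \in B -> cl z \subset B).

(** Unions of classes. In the application a class is a component of the edges that a split must not
    cut, and [N] consists of the neighbors of [t3]. *)
Definition saturated X := forall z, z \in X -> cl z \subset X.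

Definition splits a b X Y :=
  [/\ B = X :|: Y, [disjoint X & Y], conn X /\ conn Y, saturated X &
      a \in X /\ b \in Y].

(** No single class separates [N] from both [a] and [b]. *)
Definition escapes a b := forall z, z \in B -> exists s n Z,
  [/\ s = a \/ s = b, n \in N, conn Z, Z \subset B :\: cl z & (s \in Z) /\ (n \in Z)].

Lemma cl_dis z y : y \notin cl z -> [disjoint cl y & cl z].
Proof.
move=> yz; apply/disjP=> w; apply/negP=> /andP[wy wz].
by case/negP: yz; rewrite -(cl_eq wz) (cl_eq wy).
Qed.

Lemma cl_sym z y : y \in cl z -> z \in cl y.
Proof. by move=> yz; rewrite (cl_eq yz). Qed.

Lemma saturated_reach X x a :
  saturated X -> X \subset B -> a \in X -> a \notin cl x ->
  saturated (reach (X :\: cl x) [set a]).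
Proof.
move=> satX XB aX ax z zK; have := subsetP (reach_sub _ _) z zK; rewrite inE => /andP[zx zX].
apply: (reach_max (cl_cn (subsetP XB z zX)) _ (cl_refl z) zK).
by rewrite subsetD satX // cl_dis.
Qed.

(* Among the classes meeting the frontier to Y, cut X at the one leaving the largest
   part around a; moving the rest of X to Y must make Y meet N. *)
Lemma split_shrink a b X Y :
  a \in B -> escapes a b -> splits a b X Y -> (forall n, n \in N -> n \notin Y) ->
  exists X' Y', splits a b X' Y' /\
    (exists2 n, n \in N & n \in X') /\ (exists2 n, n \in N & n \in Y').
Proof.
move=> aB esc; have [n] := ubnP #|X|; elim: n X Y => // n IH X Y le_n.
case=> BXY dXY [cX cY] satX [aX bY] NY.
have XB : X \subset B by rewrite BXY subsetUl.
pose K x := reach (X :\: cl x) [set a].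
pose front x := [&& x \in X, touchb [set x] Y & a \notin cl x].
have frontI u v : u \in X -> v \in Y -> e u v -> a \notin cl u -> front u.
  by move=> uX vY uv au; rewrite /front uX au andbT; apply/touchP; exists u, v; rewrite inE.
have inXY u : u \in B -> u \notin Y -> u \in X by rewrite BXY inE => /orP[|->].
(* The frontier is nonempty: an escape avoiding the class of [a] starts at [b] in [Y], ends in [N]
   outside [Y], and enters [X] at a frontier vertex. *)
have [/existsP[x0 fx0]|nf] := boolP [exists x, front x]; last first.
  have [s [m [Z [sab mN cZ ZB [sZ mZ]]]]] := esc a aB.
  have sY : s \in Y.
    case: sab sZ => -> // aZ.
    by have := subsetP ZB a aZ; rewrite inE cl_refl.
  have [u [v [uZ uY vZ vY uv]]] := conn_exit cZ sZ sY mZ (NY m mN).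
  have := subsetP ZB v vZ; rewrite inE => /andP[va vB].
  case/negP: nf; apply/existsP; exists v; apply: (@frontI v u) => //; [exact: inXY|by rewrite eC|].
  by apply: contra va; apply: cl_sym.
have [x fx Kmax] := @arg_maxnP _ x0 front (fun x => #|K x|) fx0.
have /and3P[xX /touchP txY ax] := fx.
have axX : a \in X :\: cl x by rewrite inE ax.
have clX : cl x \subset X by apply: satX.
have xB := subsetP XB x xX.
have aX1 : [set a] \subset X :\: cl x by rewrite sub1set.
have [cW [k [y [kK yx ky]]]] := peel cX (cl_cn xB) clX (conn1 a) aX1.
have cK : conn (K x) by apply: conn_reach aX1; apply: conn1.
have aK : a \in K x by apply: (subsetP (sub_reach aX1)); rewrite inE.
have satK : saturated (K x) by apply: saturated_reach ax.
have KX : K x \subset X by apply: subset_trans (reach_sub _ _) (subsetDl _ _).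
have Kcl w : w \in cl x -> w \notin K x.
  by move=> wx; apply/negP=> /(subsetP (reach_sub _ _)); rewrite inE wx.
have sp : splits a b (K x) (Y :|: (X :\: K x)).
  split=> //.
  - rewrite BXY; apply/setP=> w; rewrite !in_setU in_setD.
    by case: (boolP (w \in K x)) => [/(subsetP KX)->|_] //=; rewrite orbC.
  - by move: KX dXY; move: (K x) => K0 *; set_solve.
  - split=> //; apply: connU => //; apply: touchC; apply: touchS txY => //.
    by rewrite sub1set in_setD xX andbT Kcl.
  - by split=> //; rewrite inE bY.
(* If the enlarged second part still misses [N], the induction applies to the smaller first part
   [K x]. *)
have [/existsP[m /andP[mN mW]]|NW] := boolP [exists m, (m \in N) && (m \in Y :|: (X :\: K x))]; last first.
  apply: IH sp _.
    rewrite -ltnS; apply: leq_trans le_n; rewrite ltnS; apply: proper_card; apply/properP.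
    by split=> //; exists x => //; apply: Kcl.
  by move=> m mN; apply: contra NW => mW; apply/existsP; exists m; rewrite mN.
have [/existsP[m' /andP[m'N m'K]]|NK] := boolP [exists m, (m \in N) && (m \in K x)].
  by exists (K x), (Y :|: (X :\: K x)); split=> //; split; [exists m'|exists m].
(* The remaining case contradicts maximality. An escape avoiding [cl x] leaves [K x :|: Y] at a
   frontier vertex [q]; cutting at [cl q] keeps all of [K x] and also the neighbor [y] in [cl x]. *)
have {}NK w : w \in N -> w \notin K x.
  by move=> wN; apply: contra NK => wK; apply/existsP; exists w; rewrite wN.
have [s [m' [Z [sab m'N cZ ZB [sZ m'Z]]]]] := esc x xB.
have sKY : s \in K x :|: Y by case: sab => ->; rewrite inE ?aK ?bY ?orbT.
have m'KY : m' \notin K x :|: Y by rewrite inE negb_or NK ?NY.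
have [p [q [pZ pKY qZ]]] := conn_exit cZ sZ sKY m'Z m'KY.
rewrite inE negb_or => /andP[qK qY] pq.
have := subsetP ZB q qZ; rewrite inE => /andP[qx qB].
have qX := inXY q qB qY.
have pY : p \in Y.
  move: pKY; rewrite inE => /orP[pK|//]; case/negP: qK.
  by apply: reach_closed pK _ pq; rewrite inE qx.
have aq : a \notin cl q.
  by apply: contra qK => aq; apply: (subsetP (satK a aK)); apply: cl_sym.
have fq : front q by apply: (@frontI q p) => //; rewrite eC.
have sq : [set a] \subset X :\: cl q by rewrite sub1set inE aq.
have KKq : K x \subset K q.
  apply: (@reach_max _ _ _ a) => //; last by apply: (subsetP (sub_reach sq)); rewrite inE.
  rewrite subsetD KX; apply/disjP=> w; apply/negP=> /andP[wK wq].
  by case/negP: qK; apply: (subsetP (satK w wK)); apply: cl_sym.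
have yq : y \notin cl q.
  by apply/negP=> yq; case/negP: qx; rewrite -(cl_eq yx) (cl_eq yq).
have : #|K x| < #|K q|.
  apply: proper_card; apply/properP; split=> //; exists y; last exact: Kcl.
  by apply: reach_closed (subsetP KKq k kK) _ ky; rewrite inE yq (subsetP clX).
by rewrite ltnNge (Kmax q fq : #|K q| <= #|K x|).
Qed.

(** The first split takes around [a] all that avoids the class of [b]. If one part misses [N],
    [split_shrink] is applied with the other part as the one to shrink, exchanging [a] and [b] when
    needed. *)
Lemma split2 a b :
  conn B -> a \in B -> b \in B -> b \notin cl a -> escapes a b ->
  exists X Y, [/\ splits a b X Y, saturated Y,
    exists2 n, n \in N & n \in X & exists2 n, n \in N & n \in Y].
Proof.
move=> cB aB bB ba esc.
have satC X Y : splits a b X Y -> saturated Y.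
  case=> BXY dXY _ satX _ z zY; apply/subsetP=> w wz.
  have zB : z \in B by rewrite BXY inE zY orbT.
  have := subsetP (cl_sub zB) w wz; rewrite BXY inE => /orP[wX|//].
  have := subsetP (satX w wX) z (cl_sym wz).
  by rewrite (disjointFl dXY zY).
have swap X Y c d : saturated Y -> splits c d X Y -> splits d c Y X.
  move=> satY [BXY dXY [cX cY] satX [cX' dY]]; split=> //.
    by rewrite BXY setUC.
  by rewrite disjoint_sym.
have escC : escapes b a.
  move=> z /esc[s [n [Z [sab ? ? ? ?]]]]; exists s, n, Z; split=> //.
  by case: sab; [right|left].
have ab : a \notin cl b by apply: contra ba; apply: cl_sym.
have satB : saturated B by move=> z; apply: cl_sub.
have aBb : [set a] \subset B :\: cl b by rewrite sub1set inE ab.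
have [cW tW] := peel cB (cl_cn bB) (cl_sub bB) (conn1 a) aBb.
pose X := reach (B :\: cl b) [set a].
have XB : X \subset B by apply: subset_trans (reach_sub _ _) (subsetDl _ _).
have sp : splits a b X (B :\: X).
  split.
  - by rewrite setUC setDE setUIl (setUC (~: X)) setUCr setIT; apply/esym/setUidPl.
  - by rewrite disjoints_subset setCD subsetUr.
  - by split=> //; apply: conn_reach => //; apply: conn1.
  - exact: saturated_reach.
  - split; first by apply: (subsetP (sub_reach aBb)); rewrite inE.
    rewrite inE bB andbT; apply/negP=> /(subsetP (reach_sub _ _)).
    by rewrite inE cl_refl.
have fin X' Y' : splits a b X' Y' /\ (exists2 n, n \in N & n \in X') /\ (exists2 n, n \in N & n \in Y') ->
    exists X Y, [/\ splits a b X Y, saturated Y,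
    exists2 n, n \in N & n \in X & exists2 n, n \in N & n \in Y].
  by case=> sp' [? ?]; exists X', Y'; split=> //; apply: satC sp'.
have [/existsP[n /andP[nN nY]]|nN] := boolP [exists n, (n \in N) && (n \in B :\: X)]; last first.
  have [|X' [Y' H]] := split_shrink aB esc sp _; last exact: fin H.
  by move=> n nN'; apply: contra nN => nY; apply/existsP; exists n; rewrite nN'.
have [/existsP[n' /andP[n'N n'X]]|n'N] := boolP [exists n, (n \in N) && (n \in X)].
  by apply: (fin X (B :\: X)); split=> //; split; [exists n'|exists n].
have [|Y' [X' [sp' [nY' nX']]]] := split_shrink bB escC (swap _ _ _ _ (satC _ _ sp) sp) _.
  by move=> m mN; apply: contra n'N => mX; apply/existsP; exists m; rewrite mN.
case: (sp') => BXY dXY [cY' cX'] satY' [bY' aX'].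
exists X', Y'; split=> //; split=> //.
- by rewrite BXY setUC.
- by rewrite disjoint_sym.
- move=> z zX; apply/subsetP=> w wz.
  have zB : z \in B by rewrite BXY inE zX orbT.
  have := subsetP (cl_sub zB) w wz; rewrite BXY inE => /orP[wY|//].
  have := subsetP (satY' w wY) z (cl_sym wz).
  by rewrite (disjointFl dXY zX).
Qed.

End Split.

(** * Transversals with a Hamiltonian path *)

(** The path is cut right after whichever of [v] and [w] comes first. *)
Lemma split_path x p v w :
  path e x p -> uniq (x :: p) -> v \in x :: p -> w \in x :: p -> v != w ->
  exists X Y, [/\ [set z in x :: p] = X :|: Y, [disjoint X & Y], conn X /\ conn Y,
    touch X Y & [/\ x \in X, last x p \in Y &
      (v \in X /\ w \in Y) \/ (w \in X /\ v \in Y)]].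
Proof.
have cp : forall q y, path e y q -> conn [set z in y :: q].
  elim=> [y _|z q IH y /= /andP[yz zq]]; first by rewrite (_ : [set _ in _] = [set y]);
    [apply: conn1 | apply/setP=> z; rewrite !inE].
  rewrite set_cons; apply: connU (conn1 y) (IH z zq) _.
  by exists y, z; rewrite !inE !eqxx.
elim: p x => [x _ _|y p IH x /=]; first by rewrite !inE => /eqP-> /eqP->; rewrite eqxx.
move=> /andP[xy yp] /andP[xp up]; rewrite [v \in _]inE [w \in _]inE => vP wP vw.
have [/orP xvw|] := boolP ((x == v) || (x == w)).
  exists [set x], [set z in y :: p]; split.
  - by rewrite set_cons.
  - by rewrite disjoints1 inE.
  - by split; [apply: conn1 | apply: cp].
  - by exists x, y; rewrite !inE !eqxx.
  split; rewrite ?inE //; first by rewrite -in_cons mem_last.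
  case: xvw => /eqP E; rewrite -E in vw vP wP *; [left|right]; split; rewrite ?inE //.
    by move: wP; rewrite eq_sym (negbTE vw) inE.
  by move: vP; rewrite (negbTE vw) inE.
rewrite negb_or => /andP[xv xw].
rewrite eq_sym (negbTE xv) /= in vP; rewrite eq_sym (negbTE xw) /= in wP.
have [X [Y [eXY dXY [cX cY] tXY [yX lY vwXY]]]] := IH y yp up vP wP vw.
exists (x |: X), Y; split.
- by rewrite set_cons eXY setUA.
- rewrite disjoints_subset subUset sub1set inE -disjoints_subset dXY andbT.
  have : x \notin X :|: Y by rewrite -eXY inE.
  by rewrite inE negb_or => /andP[].
- by split=> //; apply: connU (conn1 x) cX _; exists x, y; rewrite inE.
- by apply: touchS tXY => //; apply: subsetUr.
- split=> //; first by rewrite !inE eqxx.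
  by case: vwXY => -[vX wY]; [left|right]; rewrite !inE vX orbT.
Qed.

Section Kempe.
Implicit Types P Q : {set V}.
Variables (U T : {set V}) (col : V -> V).
(** Colors are named by their representatives in [T], so this is the union of the classes of [s] and
    [t]. *)
Definition two s t := [set x in U | (col x == s) || (col x == t)].
Hypotheses (eU : forall x y, e x y -> x \in U) (TU : T \subset U)
  (col_id : {in T, forall t, col t = t}) (col_T : {in U, forall x, col x \in T})
  (col_e : forall x y, e x y -> col x != col y)
  (kempe : {in T &, forall s t, s != t -> conn (two s t)}).

Definition clique_model (W : V -> {set V}) :=
  {in T, forall t, rooted [set t] (W t)} /\
  {in T &, forall s t, s != t -> [disjoint W s & W t] /\ touch (W s) (W t)}.

Lemma mem_two x s t : x \in U -> (x \in two s t) = (col x == s) || (col x == t).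
Proof. by move=> xU; rewrite inE xU. Qed.

Lemma colored_nbr x t :
  x \in U -> t \in T -> t != col x -> exists y, [/\ y \in U, col y = t & e x y].
Proof.
move=> xU tT tx; have tU := subsetP TU t tT.
have := @kempe (col x) t (col_T xU) tT; rewrite eq_sym => /(_ tx) c.
have [||||u [v [_ /set1P-> + _ xv]]] := @conn_exit _ [set x] x t c.
- by rewrite mem_two // eqxx.
- by rewrite inE.
- by rewrite mem_two // col_id // eqxx orbT.
- by rewrite inE; apply: contraNneq tx => tx; rewrite -tx col_id.
rewrite inE => /andP[vU]; rewrite eq_sym (negbTE (col_e xv)) => /eqP vt.
by exists v.
Qed.

(** The chain of colors [a] and [p] leads from [p], next to [Y], to [a] in [X]. It cannot step from
    [Y] to [X] directly, so it passes through a [p]-colored vertex of [P] next to both. *)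
Lemma crossing P X Y a p q r :
  a \in T -> p \in T -> a != p -> a != q -> r \notin two a p ->
  U :\: (r |: P) = X :|: Y -> [disjoint X & Y] ->
  (forall u v, u \in Y -> v \in X -> u \in two a p -> v \in two a p -> ~~ e u v) ->
  P \subset two p q -> p \in P -> touch [set p] Y -> a \in X ->
  exists2 v, v \in P & [/\ col v = p, touch [set v] X & touch [set v] Y].
Proof.
move=> aT pT ap aq rap BXY dXY noXY PU pP tpY aX.
have [tpX|ntpX] := touchP [set p] X; first by exists p => //; rewrite col_id.
(* An edge leaving [S] cannot start in its second half: its end would have color [a], hence lie off
   [P], and be in [X] or already in [S]. It starts in [Y] and ends at the required vertex. *)
pose S := (Y :&: two a p) :|: [set x in P | (col x == p) && ~~ touchb [set x] X].
have aU := subsetP TU a aT; have pU := subsetP TU p pT.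
have Pcol x : x \in P -> (x \in U) && ((col x == p) || (col x == q)).
  by move/(subsetP PU); rewrite inE.
have aP : a \notin P by apply/negP=> /Pcol; rewrite col_id // (negbTE ap) (negbTE aq) andbF.
have aS : a \notin S.
  by rewrite in_setU in_setI (disjointFr dXY aX) inE (negbTE aP).
have pS : p \in S by rewrite in_setU orbC inE pP col_id // eqxx; case: touchP ntpX.
have [||u [v [uap uS vap vS uv]]] := @conn_exit _ S p a (kempe aT pT ap) _ pS _ aS.
- by rewrite mem_two // col_id // eqxx orbT.
- by rewrite mem_two // col_id // eqxx.
have vXYP : v \in X :|: Y \/ v \in P.
  have [vP|vP] := boolP (v \in P); [by right|left].
  rewrite -BXY !inE negb_or vP andbT (eU (x := v) (y := u)) ?andbT 1?eC //.
  by apply: contraNneq rap => <-.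
have vY : v \notin Y by apply: contra vS => vY; rewrite !in_setU in_setI vY vap.
case/setUP: uS => [/setIP[uY _]|].
  exists v.
    case: vXYP => // /setUP[vX|]; last by rewrite (negbTE vY).
    by have := noXY u v uY vX uap vap; rewrite uv.
  have vP : v \in P.
    case: vXYP => // /setUP[vX|]; last by rewrite (negbTE vY).
    by have := noXY u v uY vX uap vap; rewrite uv.
  have vp : col v = p.
    move: vap; rewrite inE => /andP[_ /orP[/eqP va|/eqP//]].
    by have /andP[_] := Pcol v vP; rewrite va (negbTE ap) (negbTE aq).
  split=> //; last by exists v, u; rewrite inE eC.
  apply/touchP; apply: contraNT vS => nv.
  by rewrite in_setU orbC inE vP vp eqxx nv.
rewrite inE => /and3P[uP /eqP up nu].
have va : col v = a.
  move: vap; rewrite inE => /andP[_ /orP[/eqP//|/eqP vp]].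
  by have := col_e uv; rewrite up vp eqxx.
have vP : v \notin P by apply/negP=> /Pcol; rewrite va (negbTE ap) (negbTE aq) andbF.
case: vXYP => [/setUP[vX|vY']|]; last by rewrite (negbTE vP).
  by case/touchP: nu; exists u, v; rewrite inE.
by rewrite vY' in vY.
Qed.

Lemma path_restr_sub S x p : path (restr S) x p -> {subset p <= S}.
Proof.
elim: p x => // y p IH x /= /andP[/and3P[_ yS _] /IH pS] z.
by rewrite inE => /predU1P[->|/pS].
Qed.

Lemma clique_model5 t1 t2 t3 t4 t5 W1 W2 W3 W4 W5 :
  T = [set z in [:: t1; t2; t3; t4; t5]] -> uniq [:: t1; t2; t3; t4; t5] ->
  [/\ rooted [set t1] W1, rooted [set t2] W2, rooted [set t3] W3, rooted [set t4] W4 &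
      rooted [set t5] W5] ->
  pairwise (fun X Y => [disjoint X & Y]) [:: W1; W2; W3; W4; W5] ->
  pairwise touchb [:: W1; W2; W3; W4; W5] ->
  exists F, clique_model F.
Proof.
move=> eT u [r1 r2 r3 r4 r5] dis tou.
pose s := [:: t1; t2; t3; t4; t5]; pose Ws := [:: W1; W2; W3; W4; W5].
have rW i : i < 5 -> rooted [set nth t1 s i] (nth set0 Ws i).
  by case: i => [|[|[|[|[|i]]]]].
have sT x : x \in T -> index x s < 5 /\ nth t1 s (index x s) = x.
  by rewrite eT inE => xs; split; [rewrite -[5]/(size s) index_mem | apply: nth_index].
exists (fun x => nth set0 Ws (index x s)); split=> [x /sT[lt E]|x y /sT[ltx Ex] /sT[lty Ey] xy].
  by have := rW _ lt; rewrite E.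
wlog lt : x y xy ltx Ex lty Ey / index x s < index y s.
  move=> wl; have [lt|lt|E] := ltngtP (index x s) (index y s); first exact: wl.
    rewrite eq_sym in xy; have [d t] := wl y x xy lty Ey ltx Ex lt.
    by split; [rewrite disjoint_sym | apply: touchC].
  by move: xy; rewrite -Ex -Ey E eqxx.
split; first exact: (pairwiseP set0 dis).
by apply/touchP; apply: (pairwiseP set0 tou).
Qed.

Lemma clique_of_path t1 t2 t3 t4 t5 :
  T = [set z in [:: t1; t2; t3; t4; t5]] -> uniq [:: t1; t2; t3; t4; t5] ->
  path e t1 [:: t2; t3; t4; t5] -> exists F, clique_model F.
Proof.
move=> eT u; have := u.
rewrite /= !inE !negb_or !andbT => /and4P[].
move=> /and4P[n12 n13 n14 n15] /and3P[n23 n24 n25] /andP[n34 n35] n45 /and4P[e12 e23 e34 e45].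
have inT : [/\ t1 \in T, t2 \in T, t3 \in T, t4 \in T & t5 \in T].
  by rewrite eT !inE !eqxx !orbT.
case: inT => T1 T2 T3 T4 T5.
have U1 := subsetP TU _ T1; have U2 := subsetP TU _ T2; have U3 := subsetP TU _ T3.
have U4 := subsetP TU _ T4; have U5 := subsetP TU _ T5.
have [C1 C2 C3 C4 C5] : [/\ col t1 = t1, col t2 = t2, col t3 = t3, col t4 = t4 & col t5 = t5].
  by split; apply: col_id.
have [p [pP pU lP]] : exists p, [/\ path (restr (two t2 t4)) t2 p, uniq (t2 :: p) & last t2 p = t4].
  have [_ /(_ t2 t4)] := kempe T2 T4 n24; rewrite !mem_two // C2 C4 !eqxx !orbT.
  case/(_ isT isT)/connectP=> p pth lst; move: lst; case/shortenP: pth => q qP qU _ E.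
  by exists q.
have pe : path e t2 p by apply: sub_path pP => x y /and3P[].
pose P := [set z in t2 :: p].
have P24 : P \subset two t2 t4.
  apply/subsetP=> z; rewrite inE => /predU1P[->|zp]; first by rewrite mem_two // C2 eqxx.
  exact: path_restr_sub pP z zp.
have t2P : t2 \in P by rewrite !inE eqxx.
have t4P : t4 \in P by rewrite inE -lP mem_last.
have P42 : P \subset two t4 t2 by apply: subset_trans P24 _; apply/subsetP=> z; rewrite !inE orbC.
have colP z : z \in P -> (col z == t2) || (col z == t4).
  by move/(subsetP P24); rewrite inE => /andP[].
have notP z c : col z = c -> c != t2 -> c != t4 -> z \notin P.
  by move=> zc c2 c4; apply/negP=> /colP; rewrite zc (negbTE c2) (negbTE c4).
pose B := U :\: (t3 |: P).
have inB z : (z \in B) = [&& z != t3, z \notin P & z \in U].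
  by rewrite in_setD in_setU in_set1 negb_or andbA.
have BU : B \subset U by apply: subsetDl.
have tB z : z \in T -> z != t3 -> z != t2 -> z != t4 -> z \in B.
  by move=> zT z3 z2 z4; rewrite inB z3 (subsetP TU) // andbT; apply: (notP _ z); rewrite ?col_id.
have B1 : t1 \in B by apply: tB.
have B5 : t5 \in B by apply: tB; rewrite // eq_sym.
have two15B : two t1 t5 \subset B.
  apply/subsetP=> z; rewrite inE inB => /andP[-> zc]; rewrite andbT; apply/andP; split.
    by apply: contraTneq zc => ->; rewrite C3 ![t3 == _]eq_sym (negbTE n13) eq_sym (negbTE n35).
  by case/orP: zc => /eqP zc; apply: notP zc _ _ => //; rewrite eq_sym.
(* The chain of [t1] and [t5] lies in [B] and dominates it, since every vertex of another color has
   a neighbor colored [t1]. *)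
have cB : conn B.
  apply: (@conn_attach (two t1 t5)) => //; first exact: kempe.
  move=> z zB; have zU := subsetP BU z zB; rewrite mem_two // negb_or => /andP[z1 _].
  have [|y [yU yc zy]] := colored_nbr zU T1; first by rewrite eq_sym.
  by exists y => //; rewrite mem_two // yc eqxx.
(* The two calls of [crossing] use these color pairs, so the edges inside [A1] and inside [A5] must
   not be cut. The pairs are disjoint, so no class meets both sets. *)
pose A1 := B :&: two t1 t4; pose A5 := B :&: two t5 t2.
pose m : rel V := [rel x y | e x y && ((x \in A1) && (y \in A1) || (x \in A5) && (y \in A5))].
have mC : symmetric m by move=> x y; rewrite /m /= eC [(y \in A1) && _]andbC [(y \in A5) && _]andbC.
pose cl z := [set y | connect m z y].
have cl_refl z : z \in cl z by rewrite inE connect0.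
have cl_eq z y : y \in cl z -> cl y = cl z.
  rewrite inE => zy; apply/setP=> w; rewrite !inE.
  by rewrite (same_connect (sym_connect_sym mC) zy).
have cl_in z X : z \in X -> (forall u v, u \in X -> m u v -> v \in X) -> cl z \subset X.
  move=> zX X_m; apply/subsetP=> y; rewrite inE => zy; apply: contraT => yX.
  have [a [b [aX bX ab]]] := connect_exit zy zX yX.
  by rewrite (X_m a b aX ab) in bX.
have cl_sub z : z \in B -> cl z \subset B.
  move=> zB; apply: cl_in => // a b _ /andP[_]; rewrite !inB.
  by case/orP=> /andP[_ /setIP[]]; rewrite inB.
have cl_cn z : z \in B -> conn (cl z).
  move=> zB; apply: conn_intro; first by apply/set0Pn; exists z.
  move=> X x y xz xX yz yX; have xy : connect m x y.
    by move: yz; rewrite -(cl_eq z x xz) inE.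
  have [||a [b [/setIP[aX az] + mab]]] := @connect_exit m (X :&: cl z) x y xy.
  - by rewrite inE xX.
  - by rewrite inE (negbTE yX).
  have bz : b \in cl z by move: az; rewrite !inE => /connect_trans->; rewrite ?connect1.
  by rewrite inE bz andbT => bX; exists a, b; split=> //; case/andP: mab.
have two_dis s t s' t' z : s != s' -> s != t' -> t != s' -> t != t' ->
    z \in two s t -> z \notin two s' t'.
  move=> n1 n2 n3 n4; rewrite !inE => /andP[-> zc]; rewrite negb_or.
  by case/orP: zc => /eqP->; rewrite ?n1 ?n2 ?n3 ?n4.
have A15 z : z \in A1 -> z \notin A5.
  move/setIP=> [_ z14]; rewrite in_setI negb_and; apply/orP; right.
  by apply: two_dis z14; rewrite // eq_sym.
have clA1 z : z \in A1 -> cl z \subset A1.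
  move=> z1; apply: cl_in => // a b aA /andP[_ /orP[/andP[]//|/andP[aA5]]].
  by rewrite (negbTE (A15 a aA)) in aA5.
have clA5 z : z \in A5 -> cl z \subset A5.
  move=> z1; apply: cl_in => // a b aA /andP[_ /orP[/andP[aA1 _]|/andP[]//]].
  by rewrite (negbTE (A15 a aA1)) in aA.
have t1A : t1 \in A1 by rewrite in_setI B1 mem_two // C1 eqxx.
have t5A : t5 \in A5 by rewrite in_setI B5 mem_two // C5 eqxx.
have t5cl : t5 \notin cl t1.
  by apply/negP=> /(subsetP (clA1 t1 t1A)) /A15; rewrite t5A.
pose N := [set n in B | e t3 n].
have away c Q : c \in T -> c != t3 -> c != t2 -> c != t4 -> (forall z, z \in two t3 c -> z \notin Q) ->
    exists n Z, [/\ n \in N, conn Z, Z \subset B :\: Q & (c \in Z) /\ (n \in Z)].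
  move=> cT c3 c2 c4 dQ; have c3' : t3 != c by rewrite eq_sym.
  have cU := subsetP TU c cT.
  have s3 : [set t3] \subset two t3 c by rewrite sub1set mem_two // C3 eqxx.
  have sc : [set c] \subset two t3 c :\: [set t3].
    by rewrite sub1set in_setD inE c3 mem_two // col_id // eqxx orbT.
  have [_ [n [t [nZ /set1P-> n3]]]] := peel (kempe T3 cT c3') (conn1 t3) s3 (conn1 c) sc.
  have sB : reach (two t3 c :\: [set t3]) [set c] \subset B :\: Q.
    apply: subset_trans (reach_sub _ _) _; apply/subsetP=> z; rewrite in_setD inE => /andP[z3 zc].
    rewrite in_setD dQ // inB z3 /=; move: zc; rewrite inE => /andP[-> zc]; rewrite andbT.
    by case/orP: zc => /eqP zc; apply: notP zc _ _ => //; rewrite eq_sym.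
  exists n, (reach (two t3 c :\: [set t3]) [set c]); split=> //.
  - by rewrite inE eC n3 andbT; have := subsetP sB n nZ; rewrite in_setD => /andP[].
  - by apply: conn_reach => //; apply: conn1.
  - by split=> //; apply: (subsetP (sub_reach sc)); rewrite inE.
(* A class inside [A1] is avoided by going from [t5] to a neighbor of [t3] in colors [t3] and [t5];
   a class inside [A5] is avoided from [t1] likewise. *)
have esc : escapes B N cl t1 t5.
  move=> z zB; have zU := subsetP BU z zB.
  have [z1|z1] := boolP (z \in A1).
    have [n53 n52 n54] : [/\ t5 != t3, t5 != t2 & t5 != t4] by split; rewrite eq_sym.
    have [|n [Z H]] := @away t5 (cl z) T5 n53 n52 n54; last first.
      by exists t5, n, Z; case: H => *; split=> //; right.
    move=> y y35; apply/negP=> /(subsetP (clA1 z z1)) /setIP[_]; apply/negP.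
    by apply: two_dis y35; rewrite // eq_sym.
  have [z5|z5] := boolP (z \in A5).
    have [|n [Z H]] := @away t1 (cl z) T1 n13 n12 n14; last first.
      by exists t1, n, Z; case: H => *; split=> //; left.
    move=> y y31; apply/negP=> /(subsetP (clA5 z z5)) /setIP[_]; apply/negP.
    by apply: two_dis y31; rewrite // eq_sym.
  (* Here [z] has the color of [t3] and is alone in its class; the whole chain of [t1] and [t5]
     avoids it and contains a neighbor of [t3]. *)
  have clz : cl z \subset [set z].
    apply: cl_in; first by rewrite inE.
    by move=> a b; rewrite inE => /eqP-> /andP[_]; rewrite (negbTE z1) (negbTE z5).
  have [|n [nU nc tn]] := colored_nbr U3 T1; first by rewrite C3.
  have n15' : n \in two t1 t5 by rewrite mem_two // nc eqxx.
  exists t1, n, (two t1 t5); split; [by left| | exact: kempe| | ].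
  - by rewrite inE tn (subsetP two15B).
  - rewrite subsetD two15B /=; apply/disjP=> w; apply/negP=> /andP[w15 /(subsetP clz)].
    rewrite inE => /eqP wz; rewrite wz in w15.
    move: w15 z1 z5; rewrite !in_setI zB /= !mem_two //.
    by case/orP=> ->.
  - by split=> //; rewrite mem_two // C1 eqxx.
have [X [Y [[BXY dXY [cX cY] satX [t1X t5Y]] satY [n1 n1N n1X] [n5 n5N n5Y]]]] :=
  split2 cl_refl cl_eq cl_cn cl_sub cB B1 B5 t5cl esc.
have XB : X \subset B by rewrite BXY subsetUl.
have YB : Y \subset B by rewrite BXY subsetUr.
have mono x y Q Q' : [disjoint Q & Q'] -> saturated cl Q -> x \in Q -> y \in Q' -> ~~ m x y.
  move=> dQ satQ xQ yQ'; apply/negP=> xy.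
  have : y \in Q by apply: (subsetP (satQ x xQ)); rewrite inE connect1.
  by rewrite (disjointFl dQ yQ').
have dYX : [disjoint Y & X] by rewrite disjoint_sym.
have [v vP [vc vX vY]] : exists2 v, v \in P & [/\ col v = t4, touch [set v] X & touch [set v] Y].
  apply: (@crossing P X Y t1 t4 t2 t3) => //.
  - by rewrite mem_two // C3 eq_sym (negbTE n13) n34.
  - move=> x y xY yX x14 y14; have := mono x y Y X dYX satY xY yX.
    by rewrite /m /= !in_setI x14 y14 (subsetP YB x xY) (subsetP XB y yX) /= andbT.
  - by exists t4, t5; rewrite inE.
have [w wP [wc wY wX]] : exists2 w, w \in P & [/\ col w = t2, touch [set w] Y & touch [set w] X].
  apply: (@crossing P Y X t5 t2 t4 t3) => //.
  - by rewrite eq_sym.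
  - by rewrite eq_sym.
  - by rewrite mem_two // C3 (negbTE n35) eq_sym (negbTE n23).
  - by rewrite (setUC Y) -BXY.
  - move=> x y xX yY x14 y14; have := mono x y X Y dXY satX xX yY.
    by rewrite /m /= !in_setI x14 y14 (subsetP XB x xX) (subsetP YB y yY) /= orbT andbT.
  - by exists t2, t1; rewrite inE eC.
have vw : v != w by apply: contraNneq n24 => vw; rewrite -vc -wc vw.
have vP' : v \in t2 :: p by rewrite inE in vP.
have wP' : w \in t2 :: p by rewrite inE in wP.
(* Both [v] and [w] touch [X] and [Y], so with one of them in each half of the path, both halves
   touch both sides. *)
have [V2 [V4 [eP d24 [c2 c4] t24 [t2V2 + vw24]]]] := split_path pe pU vP' wP' vw.
rewrite lP => t4V4.
have inV x Q R : x \in Q -> touch [set x] R -> touch Q R.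
  by move=> xQ; apply: touchS => //; rewrite sub1set.
have [t2Y t4X] : touch V2 Y /\ touch X V4.
  case: vw24 => -[vQ wQ]; split.
  - exact: inV vQ vY.
  - by apply: touchC; apply: inV wQ wX.
  - exact: inV vQ wY.
  - by apply: touchC; apply: inV wQ vX.
have txy : touch X Y.
  have [x [y [_ xX yB yX xy]]] := conn_exit cB B1 t1X B5 (negbT (disjointFl dXY t5Y)).
  by exists x, y; move: yB; rewrite BXY inE (negbTE yX).
have dB Q : Q \subset P -> [disjoint B & Q].
  move=> QP; rewrite disjoint_sym disjoints_subset; apply: subset_trans QP _.
  by apply/subsetP=> z zP; rewrite inE inB zP andbF.
have V2P : V2 \subset P by rewrite /P eP subsetUl.
have V4P : V4 \subset P by rewrite /P eP subsetUr.
have t3P : t3 \notin P by apply: notP C3 _ _; rewrite // eq_sym.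
have dB3 Q : Q \subset B -> [disjoint Q & [set t3]].
  by move=> QB; rewrite disjoint_sym disjoints1; apply/negP=> /(subsetP QB); rewrite inB eqxx.
have dP3 Q : Q \subset P -> [disjoint Q & [set t3]].
  by move=> QP; rewrite disjoint_sym disjoints1; apply: contra t3P; apply: (subsetP QP).
apply: (@clique_model5 t1 t2 t3 t4 t5 X V2 [set t3] V4 Y) => //.
- by split; split; rewrite ?sub1set ?inE //; apply: conn1.
- rewrite /= (disjointWl XB (dB _ V2P)) (disjointWl XB (dB _ V4P)) dB3 // dXY dP3 // d24 andbT.
  rewrite ![[disjoint _ & Y]]disjoint_sym (disjointWl YB (dB _ V2P)) (disjointWl YB (dB _ V4P)) dB3 //.
  by rewrite disjoint_sym dP3.
- have tt (Q R : {set V}) : touch Q R -> touchb Q R by move/touchP.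
  have edge (Q R : {set V}) x y : x \in Q -> y \in R -> e x y -> touch Q R by exists x, y.
  have [[/setIdP[_ e31] /setIdP[_ e35]] t3in] := (conj n1N n5N, set11 t3).
  rewrite /= !tt //.
  + exact: edge t4V4 t5Y e45.
  + exact: edge t3in n5Y e35.
  + exact: edge t3in t4V4 e34.
  + exact: edge t2V2 t3in e23.
  + by apply: touchC; exact: edge t3in n1X e31.
  + exact: edge t1X t2V2 e12.
Qed.
End Kempe.

(** * Stars and spanning paths in a connected set *)

Lemma set_of_uniq_seq (s : seq V) S :
  uniq s -> {subset s <= S} -> size s = #|S| -> S = [set z in s].
Proof.
move=> us sS sz; apply/esym/eqP; rewrite eqEcard; apply/andP; split.
  by apply/subsetP=> z; rewrite inE; apply: sS.
by rewrite cardsE (card_uniqP us) sz.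
Qed.

Lemma notin_short (s : seq V) S : size s < #|S| -> exists2 y, y \in S & y \notin s.
Proof.
move=> lt; apply/exists_inP; rewrite -negb_forall_in; apply: contraL lt => /forall_inP sub.
rewrite -leqNgt; apply: leq_trans (card_size s); apply: subset_leq_card.
by apply/subsetP.
Qed.

(** A path with [n] edges is extended by an edge leaving it. If that edge starts at an inner vertex,
    this vertex, its two path neighbors and the new vertex form the star. *)
Lemma star_or_path S n :
  conn S -> n < #|S| ->
  (exists c x y z, [/\ uniq [:: c; x; y; z], {subset [:: c; x; y; z] <= S} &
     [/\ e c x, e c y & e c z]]) \/
  (exists x p, [/\ path e x p, uniq (x :: p), {subset x :: p <= S} & size p = n]).
Proof.
move=> cS; elim: n => [|n IH] lt.
  have [/set0Pn[x xS] _] := cS; right; exists x, [::]; split=> // y.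
  by rewrite inE => /eqP->.
case: IH => [|star|[x [p [xp up pS sp]]]]; [exact: ltnW | by left |].
have [y yS yp] : exists2 y, y \in S & y \notin x :: p.
  by apply: notin_short; rewrite /= sp.
have [||u [v [_ + vS + uv]]] := @conn_exit S [set z in x :: p] x y cS (pS _ (mem_head x p)) _ yS.
- by rewrite inE mem_head.
- by rewrite inE.
rewrite !in_set => us vp.
have [ux|ux] := eqVneq u x.
  right; exists v, (x :: p); split; rewrite /= ?sp //.
  - by rewrite xp -ux eC uv.
  - by rewrite vp.
  - by move=> z; rewrite inE => /predU1P[->|/pS].
have [ul|ul] := eqVneq u (last x p).
  right; exists x, (rcons p v); split; rewrite ?size_rcons ?sp //.
  - by rewrite rcons_path xp -ul.
  - by rewrite -rcons_cons rcons_uniq vp.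
  - by move=> z; rewrite -rcons_cons mem_rcons inE => /predU1P[->|/pS].
left; have up' : u \in p by move: us; rewrite inE (negbTE ux).
case/splitPr: up' xp up pS vp ul {yp sp us} => p1 [|z p2].
  by rewrite last_cat /= eqxx.
rewrite cat_path => /andP[_ /and3P[wu uz _]].
rewrite -cat_cons (lastI x p1) cat_rcons => up pS vp _.
pose w := last x p1; have sub3 : subseq [:: w; u; z] (w :: u :: z :: p2).
  by rewrite /= !eqxx sub0seq.
have sub : subseq [:: w; u; z] (belast x p1 ++ w :: u :: z :: p2).
  by apply: subseq_trans sub3 (suffix_subseq _ _).
have u3 := subseq_uniq sub up.
exists u, w, z, v; split.
- have : uniq (rcons [:: w; u; z] v).
    by rewrite rcons_uniq u3 andbT; apply: contra vp => /(mem_subseq sub).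
  by rewrite /= !inE (eq_sym w u) !negb_or !andbT => /and3P[/and3P[-> -> ->] /andP[-> ->] ->].
- move=> a; rewrite !inE => /or4P[] /eqP-> //; apply: pS; apply: (mem_subseq sub);
  by rewrite !inE eqxx ?orbT.
- by rewrite eC.
Qed.

End Conn.

(** * Transversals with a vertex of large degree *)

Section Star.
Variables (V : finType) (e : rel V) (U T : {set V}) (col : V -> V).
Implicit Types (X Y : {set V}) (x y z : V).
Hypotheses (eC : symmetric e) (eU : forall x y, e x y -> x \in U) (TU : T \subset U)
  (col_id : {in T, forall t, col t = t})
  (kempe : {in T &, forall s t, s != t -> conn e (two U col s t)}).

Lemma conn_subrel (r r' : rel V) X :
  {in X &, forall x y, r x y -> r' x y} -> conn r X -> conn r' X.
Proof.
move=> sub [X0 cX]; split=> // x y xX yX; move: (cX x y xX yX); apply: connect_sub.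
by move=> a b /and3P[aX bX ab]; apply: connect1; rewrite /restr /= aX bX sub.
Qed.

Lemma clique_of_star c (s : 'I_4 -> V) :
  c \in T -> injective s -> (forall i, s i \in T) -> (forall i, s i != c) ->
  {in T, forall t, t != c -> exists i, t = s i} ->
  (forall i, i != ord0 -> e c (s i)) -> exists F, clique_model e T F.
Proof.
move=> cT s_inj sT sc s_all ec.
have sU i : s i \in U by apply: (subsetP TU).
(* [d] is the one vertex not assumed adjacent to [c]. In [e'] the vertex [c] is isolated, which
   amounts to deleting it. *)
pose d := s ord0; pose e' := restr e [set~ c].
have e'C : symmetric e' := restrC eC _.
have eE' X : c \notin X -> conn e X -> conn e' X.
  move=> cX; apply: conn_subrel => x y xX yX xy.
  have nc z : z \in X -> z \in [set~ c] by move=> zX; rewrite !inE; apply: contraNneq cX => <-.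
  by rewrite /e' /restr /= !nc.
have dT : d \in T := sT _.
have dc : d != c := sc _.
have cd : c != d by rewrite eq_sym.
have s1 : [set c] \subset two U col c d.
  by rewrite sub1set inE (subsetP TU) // col_id // eqxx.
have s2 : [set d] \subset two U col c d :\: [set c].
  by rewrite sub1set in_setD in_set1 dc inE (subsetP TU) // col_id // eqxx orbT.
pose Y := reach e (two U col c d :\: [set c]) [set d].
have [_ tYc] := peel eC (kempe cT (sT _) cd) (conn1 e c) s1 (conn1 e d) s2.
have cY : conn e Y by apply: conn_reach => //; apply: conn1.
have dY : d \in Y by apply: (subsetP (sub_reach _ s2)); rewrite inE.
have YS : Y \subset two U col c d :\: [set c] by apply: reach_sub.
have cnY : c \notin Y by apply/negP=> /(subsetP YS); rewrite !inE eqxx.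
(* The class of [c], without [c], is merged into the class of [d], so that the root set [Y] fits
   into it; links at this class are enlarged by [Y]. *)
pose A i := [set x in U | (x != c) && ((col x == s i) || (i == ord0) && (col x == c))].
pose T0 i := if i == ord0 then Y else [set s i].
have twoA i j : i != j -> two U col (s i) (s j) \subset A i :|: A j.
  move=> ij; apply/subsetP=> x; rewrite !inE => /andP[-> xc] /=.
  have -> : x != c.
    apply: contraTneq xc => ->; rewrite col_id // ![c == _]eq_sym.
    by rewrite (negbTE (sc i)) (negbTE (sc j)).
  by case/orP: xc => ->; rewrite ?orbT.
have YA : Y \subset A ord0.
  apply/subsetP=> x /(subsetP YS); rewrite !inE => /andP[-> /andP[-> /orP[->|->]]] //.
  by rewrite orbT.
have link i j : i != j -> j != ord0 ->
    exists Z, [/\ conn e' Z, T0 i \subset Z, T0 j \subset Z & Z \subset A i :|: A j].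
  move=> ij j0; have sij : s i != s j by rewrite (inj_eq s_inj).
  have cij := kempe (sT i) (sT j) sij; have sA := twoA i j ij.
  have cA k : c \notin A k by rewrite inE eqxx andbF.
  have si : s i \in two U col (s i) (s j) by rewrite inE sU col_id // eqxx.
  have sj : s j \in two U col (s i) (s j) by rewrite inE sU col_id // eqxx orbT.
  have cZ (Z : {set V}) : Z \subset A i :|: A j -> c \notin Z.
    by move=> ZA; apply/negP=> /(subsetP ZA); rewrite in_setU !(negbTE (cA _)).
  rewrite /T0 (negbTE j0); case: eqP => [i0|_].
    have ZA : two U col (s i) (s j) :|: Y \subset A i :|: A j.
      by rewrite subUset sA {1}i0 (subset_trans YA) // subsetUl.
    exists (two U col (s i) (s j) :|: Y); split=> //.
    - apply: eE'; first exact: cZ.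
      by apply: connU_meet cij cY si _; rewrite i0.
    - exact: subsetUr.
    - by rewrite sub1set in_setU sj.
  by exists (two U col (s i) (s j)); split; rewrite ?sub1set //; apply: eE'; first exact: cZ.
have sysA : link_system e' A T0.
  split.
  - move=> i; rewrite /T0; case: ifP => _; apply: eE' => //; last exact: conn1.
    by rewrite inE eq_sym.
  - move=> i; rewrite /T0; case: eqP => [->//|_].
    by rewrite sub1set inE sU sc col_id // eqxx.
  - move=> i j ij; rewrite -setI_eq0; apply/eqP/setP=> x; rewrite !inE.
    apply/negP=> /andP[/andP[_ /andP[_ xi]] /andP[_ /andP[_ xj]]].
    have cs k : (c == s k) = false by rewrite eq_sym (negbTE (sc k)).
    case/orP: xi => [/eqP xi|/andP[/eqP i0 /eqP xi]]; rewrite xi in xj.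
      by move: xj; rewrite (inj_eq s_inj) (negbTE ij) (negbTE (sc i)) andbF.
    by move: xj; rewrite cs eqxx andbT /= -i0 eq_sym (negbTE ij).
  move=> i j ij; have [j0|j0] := eqVneq j ord0; last exact: link.
  have ji : j != i by rewrite eq_sym.
  have [|Z [? ? ? ZA]] := link j i ji _; first by rewrite -j0.
  by exists Z; split; rewrite // setUC.
have [W [rW dW]] := rooted_clique_of_links e'C sysA.
have sW i : s i \in W i.
  have [_ /subsetP TW] := rW i; apply: TW; rewrite /T0.
  by case: eqP => [->|_] //; rewrite inE.
(* A connected set of [e'] containing [s i] cannot contain the isolated vertex [c], so [[set c]] can
   be added as the fifth set. *)
have cW i : c \notin W i.
  have [cn' _] := rW i; apply/negP=> ci.
  have [||u [v [_ /set1P-> _ _ /and3P[]]]] := @conn_exit _ _ _ [set c] c (s i) cn' ci _ (sW i).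
  - by rewrite inE.
  - by rewrite inE.
  by rewrite !inE eqxx.
have cnW i : conn e (W i).
  by have [cn' _] := rW i; apply: conn_subrel cn' => x y _ _ /and3P[].
have tcW i : touch e [set c] (W i).
  have [i0|i0] := eqVneq i ord0; last by exists c, (s i); rewrite inE ec.
  apply: touchC => //; apply: touchS tYc => //.
  by have [_] := rW i; rewrite /T0 i0 eqxx.
pose F x := if [pick i | s i == x] is Some i then W i else [set c].
have Fs i : F (s i) = W i.
  rewrite /F; case: pickP => [j /eqP/s_inj->//|/(_ i)]; by rewrite eqxx.
have Fc : F c = [set c].
  by rewrite /F; case: pickP => // i; rewrite (negbTE (sc i)).
exists F; split=> [t tT|t t' tT t'T tt'].
  have [->|tc] := eqVneq t c; first by rewrite Fc; split; [apply: conn1|].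
  by have [i ->] := s_all t tT tc; rewrite Fs; split=> //; rewrite sub1set.
have [Et|tc] := eqVneq t c; have [Et'|t'c] := eqVneq t' c.
- by rewrite Et Et' eqxx in tt'.
- have [i ->] := s_all t' t'T t'c; rewrite Et Fc Fs; split=> //.
  by rewrite disjoints1.
- have [i ->] := s_all t tT tc; rewrite Et' Fc Fs; split; last exact: touchC.
  by rewrite disjoint_sym disjoints1.
have [i Ei] := s_all t tT tc; have [j Ej] := s_all t' t'T t'c.
have [|dij [x [y [xi yj /and3P[_ _ xy]]]]] := dW i j.
  by apply: contraNneq tt' => ij; rewrite Ei Ej ij.
by rewrite Ei Ej !Fs; split=> //; exists x, y.
Qed.

(** A path with four edges exhausts the five vertices of [T]; a star leaves exactly one further
    vertex [d]. *)
Lemma clique_of_kempe :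
  {in U, forall x, col x \in T} -> (forall x y, e x y -> col x != col y) ->
  conn e T -> #|T| = 5 -> exists F, clique_model e T F.
Proof.
move=> col_T col_e cT T5.
have [|[c [x [y [z [u4 sub [cx cy cz]]]]]]|[t1 [p [tp up sub sp]]]] :=
    @star_or_path _ _ eC T 4 cT; first by rewrite T5.
  have [d dT d4] : exists2 d, d \in T & d \notin [:: c; x; y; z] by apply: notin_short; rewrite T5.
  have u5 : uniq [:: d; c; x; y; z] by rewrite cons_uniq d4.
  have eT : T = [set t in [:: d; c; x; y; z]].
    by apply: set_of_uniq_seq => // t; rewrite inE => /predU1P[->|/sub].
  have u5' : uniq [:: c; d; x; y; z].
    by rewrite -(perm_uniq (_ : perm_eq [:: d; c; x; y; z] _)) // (perm_catCA [:: d] [:: c]).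
  (* [d] comes first, so that [ord0] indexes the vertex not known to be adjacent to [c]. *)
  have [cl ul] := andP u5'; pose l := [:: d; x; y; z].
  have lT t : t \in l -> t \in T.
    rewrite inE => /predU1P[->//|tl]; apply: sub; by rewrite inE tl orbT.
  have ml (i : 'I_4) : nth c l i \in l by apply: mem_nth.
  apply: (@clique_of_star c (fun i => nth c l i)).
  - by rewrite sub ?mem_head.
  - by move=> i j /eqP; rewrite nth_uniq // => /eqP/val_inj.
  - by move=> i; apply: lT.
  - by move=> i; apply: contraNneq cl => <-.
  - move=> t; rewrite eT !inE => tl tc; rewrite (negbTE tc) /= in tl.
    have tl' : t \in l by rewrite !inE.
    have lt : index t l < 4 by rewrite -[4]/(size l) index_mem.
    by exists (Ordinal lt); rewrite nth_index.
  - by case=> [[|[|[|[|i]]]]].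
case: p tp up sub sp => [|t2 [|t3 [|t4 [|t5 [|? ?]]]]] // tp up sub _.
apply: (clique_of_path eC eU TU col_id col_T col_e kempe _ up tp).
by apply: set_of_uniq_seq => //; rewrite T5.
Qed.

End Star.

(** * Kempe colorings *)

Lemma connected_induced (V : finType) (G : graph V) (X : {set V}) :
  X \subset vertices G -> reflect (conn (adj G) X) (connected (induced G X)).
Proof.
move=> /setIidPr GX; rewrite /connected /= GX.
apply: (iffP andP) => -[X0 cX]; split=> //.
  by move=> x y xX yX; have /forall_inP/(_ x xX)/forall_inP/(_ y yX) := cX.
by apply/forall_inP=> x xX; apply/forall_inP=> y yX; apply: cX.
Qed.

Theorem corollary1 (V : finType) (G : graph V) (C : {set {set V}})
    (T : {set V}) :
  kempe_coloring G C ->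
  #|C| = 5 ->
  is_transversal T C (vertices G) ->
  connected (induced G T) ->
  exists W : V -> {set V}, rooted_certificate G (complete_graph T) W.
Proof.
move=> /kempe_coloringP[/andP[partC /forall_inP anti] kempe] C5 trT conT.
have [/and3P[/eqP coverC trivC _] TU _] := and3P trT.
(* The first argument [x] of [transversal_repr] is a default value, taken only if [T] misses the
   block. *)
pose col x := transversal_repr x T (pblock C x).
have eC : symmetric (adj G) := @adj_sym V G.
have blockC x : x \in vertices G -> pblock C x \in C by rewrite -coverC => /pblock_mem.
have blockU A : A \in C -> A \subset vertices G by move=> /anti/andP[].
have col_T : {in vertices G, forall x, col x \in T}.
  by move=> x /blockC; apply: (repr_mem_transversal trT).
have col_block x : x \in vertices G -> pblock C (col x) = pblock C x.
  by move=> /blockC xC; apply: (transversal_reprK trT).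
have col_id : {in T, forall t, col t = t}.
  by move=> t tT; apply: (pblockK trT).
have colE x t : x \in vertices G -> t \in T -> (col x == t) = (x \in pblock C t).
  move=> xU tT; apply/eqP/idP => [<-|xt].
    by rewrite col_block // mem_pblock coverC.
  apply: (pblock_inj trT) => //; first exact: col_T.
  rewrite col_block //; apply: def_pblock => //; apply: blockC.
  exact: (subsetP TU).
have twoE s t : s \in T -> t \in T -> two (vertices G) col s t = pblock C s :|: pblock C t.
  move=> sT tT; apply/setP=> x; rewrite inE in_setU.
  have [xU|xU] := boolP (x \in vertices G); first by rewrite !colE.
  apply/esym/negbTE; rewrite negb_or.
  by apply/andP; split; apply: contra xU; apply/subsetP/blockU/blockC/(subsetP TU).
have kempeT : {in T &, forall s t, s != t -> conn (adj G) (two (vertices G) col s t)}.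
  move=> s t sT tT st; have sC := blockC _ (subsetP TU s sT); have tC := blockC _ (subsetP TU t tT).
  rewrite twoE //; apply/connected_induced; first by rewrite subUset !blockU.
  by apply: kempe => //; apply: contraNneq st => /(pblock_inj trT sT tT)->.
have col_e x y : adj G x y -> col x != col y.
  move=> xy; apply/eqP=> Exy; have xU := adj_vertices xy.
  have yU : y \in vertices G by rewrite eC in xy; apply: adj_vertices xy.
  have /andP[_ /forall_inP/(_ x)] := anti _ (blockC x xU).
  rewrite mem_pblock coverC => /(_ xU) /forall_inP/(_ y).
  by rewrite -col_block // Exy col_block // mem_pblock coverC xy => /(_ yU).
have cT : conn (adj G) T by apply/connected_induced.
have T5 : #|T| = 5 by rewrite (card_transversal trT).
have [W [rW dW]] :=
  clique_of_kempe eC (@adj_vertices V G) TU col_id kempeT col_T col_e cT T5.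
(* A connected set that contains [t] cannot leave [vertices G], since every edge has both ends
   there. *)
have WU t : t \in T -> W t \subset vertices G.
  move=> tT; have [cW] := rW t tT; rewrite sub1set => tW; have tU := subsetP TU t tT.
  apply/subsetP=> x xW; apply: contraT => xU.
  have [u [v [_ uU _ vU uv]]] := conn_exit cW tW tU xW xU.
  by rewrite eC in uv; rewrite (adj_vertices uv) in vU.
exists W; split=> //=.
- by move=> s t sT tT st; case: (dW s t sT tT st).
- move=> t tT; have [cW] := rW t tT; rewrite sub1set => tW; split=> //.
  by apply/connected_induced => //; apply: WU.
- by move=> s t /and3P[sT tT st]; case: (dW s t sT tT st).
Qed.
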